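(* Let $S=(b_1^{(m_1)},b_2^{(m_2)},\ldots,b_l^{(m_l)})$ be a tree eccentric sequence with $m_1+m_2+\cdots+m_l>2$, and let $\mathcal{I}\in\{W'_e,W_e,W_{ve},W_{+},W_{-}\}$. Then $\mathbb{T}(m_l-2,m_{l-1}-2,\ldots,m_2-2)$ is the unique tree (up to isomorphism) with eccentric sequence $S$ that minimises $\mathcal{I}$ among all trees with eccentric sequence $S$.
   Context: All graphs are finite and simple. In a connected graph $G$ with vertex set $V(G)$ and edge set $E(G)$, $d(u,v)$ is the length of a shortest $u$-$v$ path, $\deg(u)$ is the degree of $u$, and the eccentricity of a vertex $u$ is $\max_{v\in V(G)}d(u,v)$. The eccentric sequence of $G$ is the nondecreasing sequence of the eccentricities of all vertices of $G$. It is written $(b_1^{(m_1)},\ldots,b_l^{(m_l)})$, meaning that $G$ has precisely $l$ distinct eccentricities $b_1<b_2<\cdots<b_l$ and that exactly $m_i\ge 1$ vertices have eccentricity $b_i$ (so $|V(G)|=m_1+\cdots+m_l$ and $b_l$ is the diameter). A sequence is a tree eccentric sequence if it is the eccentric sequence of some tree. For a vertex $u$ and an edge $e=vw$, $d(u,e)=\min\{d(u,v),d(u,w)\}$. For edges $e=vw$ and $f$, $d(e,f)=\min\{d(v,f),d(w,f)\}$. For edges $e,f$, $d'(e,f)$ is the distance between the corresponding vertices in the line graph of $G$. Define (sums over $\{e,f\}\subseteq E(G)$ or $\{u,v\}\subseteq V(G)$ are over unordered pairs of distinct elements): - $W_e(G)=\sum_{\{e,f\}\subseteq E(G)}d(e,f)$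 (edge Wiener index); - $W'_e(G)=\sum_{\{e,f\}\subseteq E(G)}d'(e,f)$; - $W_{ve}(G)=\frac12\sum_{v\in V(G),\,e\in E(G)}d(v,e)$ (vertex-edge Wiener index); - $W_{+}(G)=\sum_{\{u,v\}\subseteq V(G)}d(u,v)(\deg(u)+\deg(v))$ (Schultz index, or degree distance); - $W_{-}(G)=\sum_{\{u,v\}\subseteq V(G)}d(u,v)\deg(u)\deg(v)$ (Gutman index). A pendant vertex is a vertex of degree $1$. A caterpillar is a tree such that removing all pendant vertices produces a path. Given an integer $q>0$, let $r=q/2$ if $q$ is even and $r=(q+1)/2$ if $q$ is odd. For nonnegative integers $t_1,\ldots,t_r$, $\mathbb{T}(t_1,\ldots,t_r)$ is the caterpillar constructed from the path $v_0,v_1,\ldots,v_{q+1}$ by attaching $t_j$ new pendant vertices at $v_j$ for all $1\le j\le r$. In the notation $\mathbb{T}(m_l-2,m_{l-1}-2,\ldots,m_2-2)$ associated with $S$, the integer $q$ is $q=b_l-1$ (so the path $v_0,\ldots,v_{q+1}$ has length $b_l$), $r=l-1$, and $t_j=m_{l+1-j}-2$ for $1\le j\le l-1$. *)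

(* Defs.v *)
From mathcomp Require Import all_boot all_order all_algebra.

Set Implicit Arguments.
Unset Strict Implicit.
Unset Printing Implicit Defensive.

Record sgraph := SGraph {
  vertex :> finType;
  adj : rel vertex;
  adj_sym : symmetric adj;
  adj_irr : irreflexive adj }.

Definition iso (G H : sgraph) : Prop :=
  exists2 f : G -> H, bijective f & {mono f : x y / adj x y}.

Definition connected (G : sgraph) : Prop :=
  0 < #|G| /\ forall u v : G, connect (@adj G) u v.

(* A [ucycle] of size 1 is excluded by irreflexivity, and one of size 2 is an
   edge traversed back and forth. *)
Definition acyclic (G : sgraph) : Prop :=
  forall c : seq G, ucycle (@adj G) c -> size c <= 2.

Definition is_tree (G : sgraph) : Prop := connected G /\ acyclic G.

Definition walk_of_length (G : sgraph) (n : nat) (u v : G) : bool :=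
  [exists p : n.-tuple G, path (@adj G) u p && (last u p == v)].

(* The least length of a walk from u to v.  A shortest walk has no repeated
   vertex, hence length < #|G|; the value is #|G| if v is unreachable. *)
Definition dist (G : sgraph) (u v : G) : nat :=
  find (fun n => walk_of_length n u v) (iota 0 #|G|).

Definition deg (G : sgraph) (u : G) : nat := #|[set v | adj u v]|.

Definition ecc (G : sgraph) (u : G) : nat := \max_(v : G) dist u v.

Definition ecc_seq (G : sgraph) : seq nat := sort leq [seq ecc u | u : G].

(* The sequence denoted by (b_1^(m_1), ..., b_l^(m_l)). *)
Definition seq_of_mult (b m : seq nat) : seq nat :=
  flatten [seq nseq p.2 p.1 | p <- zip b m].

Definition tree_ecc_seq (s : seq nat) : Prop :=
  exists2 G : sgraph, is_tree G & ecc_seq G = s.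

Definition edges (G : sgraph) : {set {set G}} :=
  [set [set p.1; p.2] | p in [set p : G * G | adj p.1 p.2]].

Definition edge (G : sgraph) : finType := {e : {set G} | e \in edges G}.

(* [dist] is at most #|G|, so the index #|G| is neutral in the two minima. *)
Definition dist_ve (G : sgraph) (u : G) (e : edge G) : nat :=
  \big[minn/#|G|]_(x in val e) dist u x.

Definition dist_ee (G : sgraph) (e f : edge G) : nat :=
  \big[minn/#|G|]_(x in val e) dist_ve x f.

Definition line_adj (G : sgraph) : rel (edge G) :=
  fun e f => (e != f) && (val e :&: val f != set0).

Lemma line_adj_sym (G : sgraph) : symmetric (@line_adj G).
Proof. by move=> e f; rewrite /line_adj eq_sym setIC. Qed.

Lemma line_adj_irr (G : sgraph) : irreflexive (@line_adj G).
Proof. by move=> e; rewrite /line_adj eqxx. Qed.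

Definition line_graph (G : sgraph) : sgraph :=
  SGraph (@line_adj_sym G) (@line_adj_irr G).

Definition dist_line (G : sgraph) (e f : edge G) : nat :=
  @dist (line_graph G) e f.

(* Sum of a symmetric F over the unordered pairs of distinct elements, each
   represented by the ordered pair that is increasing for [enum_rank]. *)
Definition sum_pairs (T : finType) (F : T -> T -> nat) : nat :=
  \sum_(x : T) \sum_(y : T | enum_rank x < enum_rank y) F x y.

Inductive top_index :=
  | EdgeWienerLine
  | EdgeWiener
  | VertexEdgeWiener
  | Schultz
  | Gutman.

(* Rational-valued because of the factor 1/2 in the vertex-edge index. *)
Definition index_val (I : top_index) (G : sgraph) : rat :=
  match I with
  | EdgeWienerLine => (sum_pairs (@dist_line G))%:R
  | EdgeWiener => (sum_pairs (@dist_ee G))%:R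
  | VertexEdgeWiener =>
      (2%:R^-1 * (\sum_(v : G) \sum_(e : edge G) dist_ve v e)%N%:R)%R
  | Schultz =>
      (sum_pairs (fun u v : G => dist u v * (deg u + deg v)))%:R
  | Gutman =>
      (sum_pairs (fun u v : G => dist u v * (deg u * deg v)))%:R
  end.

(* The vertex [inl i] is v_i, and [inr (Tagged _ k)] with tag j is the k-th
   pendant vertex attached at v_(j+1): the tag and the list t count from 0, so
   nth 0 t j is t_(j+1).  The upper half of q is r. *)
Definition cat_vertex (q : nat) (t : seq nat) : finType :=
  ('I_q.+2 + {j : 'I_(uphalf q) & 'I_(nth 0 t j)})%type.

Definition cat_adj (q : nat) (t : seq nat) : rel (cat_vertex q t) :=
  fun x y =>
    match x, y with
    | inl i, inl j => (i.+1 == j :> nat) || (j.+1 == i :> nat)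
    | inl i, inr p => i == (tag p).+1 :> nat
    | inr p, inl i => i == (tag p).+1 :> nat
    | inr _, inr _ => false
    end.

Lemma cat_adj_sym q t : symmetric (@cat_adj q t).
Proof. by move=> [i|p] [j|p'] //=; rewrite orbC. Qed.

Lemma cat_adj_irr q t : irreflexive (@cat_adj q t).
Proof. by move=> [i|p] //=; rewrite orbb gtn_eqF. Qed.

Definition caterpillar (q : nat) (t : seq nat) : sgraph :=
  SGraph (@cat_adj_sym q t) (@cat_adj_irr q t).

Definition minimises (I : top_index) (s : seq nat) (G : sgraph) : Prop :=
  [/\ is_tree G, ecc_seq G = s &
      forall H : sgraph, is_tree H -> ecc_seq H = s ->
        (index_val I G <= index_val I H)%R].

(* Main.v *)
Require Import Defs.
From mathcomp Require Import all_boot all_order all_algebra.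
From mathcomp Require Import zify.

(* On a tree of order n each of the five indices is an increasing affine
   function of the Wiener index W, so it suffices to minimise W. Root the tree
   at its centre (in the bicentral case, at one of the two central vertices).
   Writing s(w) for the number of descendants of w, W is the sum of
   s(w)(n-s(w)) over the vertices w other than the root. Up to a constant, the
   eccentricity of a vertex is its level, that is, its distance to the centre,
   so the eccentric sequence fixes the number of vertices on each level k, and
   for k > 0 also the sum of s over level k. Two vertices of level k lie on a
   fixed diametral path and have s >= h+1-k, where h is the largest level; the
   others have s >= 1. By convexity the sum of s^2 over the level is largest
   when all the excess over these lower bounds sits on a single vertex of the
   path; likewise the term of a central edge is smallest when one side is just
   half of the path. The caterpillar attains this on all levels at once, and a
   tree attaining it has all its vertices off the path pendant and attached to
   the same half of the path. *)

Set Implicit Arguments.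
Unset Strict Implicit.
Unset Printing Implicit Defensive.

(** * Distances and rooted trees *)

(** Everything rests on one identity: the Wiener index plus a quantity fixed by the sequence equals
    another such quantity plus a sum of nonnegative defects. Minimality and the equality case are
    then both read off from a vanishing defect. The square sums do not see which half of the path
    carries the excess, so different levels could a priori choose different halves. Level 1, or the
    central edge in the bicentral case, settles this: there the lighter half must be a bare path,
    which leaves all excess to the other half. Hence [y] is chosen in advance as an end with at
    least as many vertices nearer to it as to [x]. With two central vertices the root [r] is the one
    on the side of [x] and [c] the one on the side of [y]. Both have level 0, so level and depth
    differ below [c], and an ancestor is determined by its level only when that level is positive.
    The 2 subtracted in the parameters of the caterpillar accounts for the two path vertices of each
    positive level. *)

Section Distance.
Variable G : sgraph.
Implicit Types (u v w : G) (p : seq G).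

Lemma dist_le_size u p : path (@adj G) u p -> dist u (last u p) <= size p.
Proof.
move=> up; rewrite leqNgt; apply/negP => lt_p.
have le_n: size p < #|G|.
  apply: leq_trans lt_p _; rewrite /dist.
  by rewrite (leq_trans (find_size _ _)) // size_iota.
have W: walk_of_length (size p) u (last u p).
  by apply/existsP; exists (in_tuple p); rewrite up eqxx.
by have := before_find 0 lt_p; rewrite nth_iota // add0n W.
Qed.

Lemma dist_path u v : connect (@adj G) u v ->
  exists p, [/\ path (@adj G) u p, last u p = v & size p = dist u v].
Proof.
case/connectP=> p up def_v.
have hasW: has (fun n => walk_of_length n u v) (iota 0 #|G|).
  case/shortenP: up def_v => q uq Uq _ ->.
  apply/hasP; exists (size q).
    by rewrite mem_iota add0n -[(size q).+1]/(size (u :: q)) -(card_uniqP Uq) max_card.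
  rewrite /walk_of_length; apply/existsP; exists (in_tuple q); by rewrite uq eqxx.
have:= nth_find 0 hasW; rewrite nth_iota ?add0n; last first.
  by rewrite -[X in _ < X](size_iota 0) -has_find.
rewrite /walk_of_length; case/existsP=> q /andP[uq /eqP lq]; exists q; split=> //.
exact: size_tuple.
Qed.

Lemma dist_refl u : dist u u = 0.
Proof. apply/eqP; rewrite -leqn0; exact: (@dist_le_size u [::]). Qed.

Lemma dist0_eq u v : connect (@adj G) u v -> dist u v = 0 -> u = v.
Proof. by case/dist_path=> p [_ <- <-] /size0nil ->. Qed.

Lemma dist_adj u v w : connect (@adj G) u v -> adj v w -> dist u w <= (dist u v).+1.
Proof.
case/dist_path=> p [up <- <-] vw.
have := @dist_le_size u (rcons p w); rewrite last_rcons size_rcons rcons_path.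
by rewrite up vw; apply.
Qed.

Lemma dist_pred u v : connect (@adj G) u v -> u != v ->
  exists2 w, adj w v & (dist u w).+1 = dist u v.
Proof.
move=> cuv; case/dist_path: (cuv) => p [up lp sp] neq.
case/lastP: p up lp sp => [|p w]; first by move=> _ /= eq_uv; rewrite eq_uv eqxx in neq.
rewrite rcons_path last_rcons size_rcons => /andP[up pw] eq_w sp; subst w.
exists (last u p) => //; apply/eqP; rewrite eqn_leq dist_adj //; last by apply/connectP; exists p.
by rewrite andbT -sp ltnS dist_le_size.
Qed.

End Distance.

(** * Minima over finite sets with a large default value *)

Section BigMin.
Variables (T : finType) (A : {set T}) (N : nat) (F : T -> nat).

Lemma leq_bigmin k : k <= N ->
  (k <= \big[minn/N]_(x in A) F x) = [forall x in A, k <= F x].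
Proof.
move=> leN; rewrite (big_morph (leq k) (id1 := true) (op1 := andb)) ?big_andE //.
by move=> i j; rewrite leq_min.
Qed.

Lemma bigmin_le_idx : \big[minn/N]_(x in A) F x <= N.
Proof. by elim/big_rec: _ => // i m _ le_m; rewrite geq_min le_m orbT. Qed.

Lemma bigmin_le x : x \in A -> \big[minn/N]_(x in A) F x <= F x.
Proof.
move=> Ax; have := leq_bigmin bigmin_le_idx; rewrite leqnn => /esym/forall_inP.
exact.
Qed.

End BigMin.

Lemma bigmin_set2 (T : finType) (N : nat) (F : T -> nat) a b :
  F a <= N -> \big[minn/N]_(x in [set a; b]) F x = minn (F a) (F b).
Proof.
move=> leN; apply/eqP; rewrite eqn_leq leq_min !bigmin_le ?set21 ?set22 //=.
rewrite leq_bigmin ?geq_min ?leN //.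
by apply/forall_inP => x; rewrite !inE => /orP[] /eqP->; rewrite geq_min leqnn ?orbT.
Qed.

(** The root is its own parent, which makes [par] total; the conjunct [u != v] keeps this loop out
    of the adjacency. *)
Definition rooted (G : sgraph) (r : G) (par : G -> G) : Prop :=
  [/\ par r = r, forall v, fconnect par v r
    & forall u v, adj u v = (u != v) && ((u == par v) || (v == par u))].

(* The breadth-first spanning tree; an edge outside it would close a cycle. *)
Lemma tree_rooted (G : sgraph) (r : G) : is_tree G -> exists par, rooted r par.
Proof.
case=> [[_ conn] acyc].
pose par v := if v == r then r else odflt v [pick u | adj u v && ((dist r u).+1 == dist r v)].
have par_r: par r = r by rewrite /par eqxx.
have parP v : v != r -> adj (par v) v /\ (dist r (par v)).+1 = dist r v.
  move=> vr; rewrite /par (negPf vr); case: pickP => [u /andP[? /eqP] // | no_u].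
  have [|w wv dw] := dist_pred (conn r v); first by rewrite eq_sym.
  by have := no_u w; rewrite wv dw eqxx.
have reach v : fconnect par v r.
  have [k] := ubnP (dist r v); elim: k v => // k IHk v lt_k.
  have [-> | /parP[_ dv]] := eqVneq v r; first exact: connect0.
  by apply: connect_trans (fconnect1 par v) (IHk _ _); rewrite -dv in lt_k.
exists par; split=> // u v; apply/idP/andP=> [uv | [neq_uv /orP[]/eqP def]]; last 2 first.
- have [eq_v | /parP[]] := eqVneq v r; last by rewrite -def.
  by rewrite def eq_v par_r eqxx in neq_uv.
- have [eq_u | /parP[]] := eqVneq u r; last by rewrite -def adj_sym.
  by rewrite def eq_u par_r eqxx in neq_uv.
have neq_uv: u != v by apply: contraTneq uv => ->; rewrite adj_irr.
split=> //.
pose e' : rel G := fun a b => (a != b) && ((a == par b) || (b == par a)).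
have e'_sym: symmetric e' by move=> a b; rewrite /e' eq_sym orbC.
have e'_adj: subrel e' (@adj G).
  move=> a b /andP[neq /orP[]/eqP def].
    have [eq_v | /parP[]] := eqVneq b r; last by rewrite -def.
    by rewrite def eq_v par_r eqxx in neq.
  have [eq_v | /parP[]] := eqVneq a r; last by rewrite -def adj_sym.
  by rewrite def eq_v par_r eqxx in neq.
have e'_r a : connect e' a r.
  apply: connect_sub (reach a) => z t /eqP <-.
  have [<- | neq] := eqVneq z (par z); first by rewrite connect0.
  by apply: connect1; rewrite /e' neq eqxx orbT.
have: connect e' u v.
  by apply: connect_trans (e'_r u) _; rewrite (sym_connect_sym e'_sym).
case/connectP=> p0 up0 def_v; case/shortenP: up0 def_v => p up Up _ def_v.
have := acyc (u :: p); rewrite /ucycle Up andbT /= rcons_path (sub_path e'_adj) //=.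
rewrite -def_v adj_sym uv => /(_ isT).
case: p up {Up} def_v => [_ /= eq_vu|a [|//]]; first by rewrite eq_vu eqxx in neq_uv.
by rewrite /= andbT => /andP[_ ua] ->; rewrite ua.
Qed.

(** Locked so that [inE] does not unfold membership in an ancestor set. *)
Definition anc (T : finType) (par : T -> T) (v : T) : {set T} :=
  locked [set w | fconnect par v w].

Lemma in_anc (T : finType) (par : T -> T) (v w : T) :
  (w \in anc par v) = fconnect par v w.
Proof. by rewrite /anc -lock inE. Qed.

(** * Ancestor sets and their symmetric differences *)

Section Ancestors.
Variables (T : finType) (par : T -> T) (r : T).
Hypotheses (par_r : par r = r) (reach : forall v, fconnect par v r).
Implicit Types u v w z : T.
Local Notation A := (anc par).

Lemma anc_refl v : v \in A v.
Proof. by rewrite in_anc connect0. Qed.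

Lemma anc_root v : r \in A v.
Proof. by rewrite in_anc. Qed.

Lemma anc_sub u v : (u \in A v) = (A u \subset A v).
Proof.
apply/idP/subsetP=> [|sub]; last exact/sub/anc_refl.
by rewrite in_anc => vu w; rewrite !in_anc; apply: connect_trans.
Qed.

Lemma anc_trans u v w : u \in A v -> v \in A w -> u \in A w.
Proof. by move=> uv; rewrite anc_sub => /subsetP; apply. Qed.

Lemma anc_par v : par v \in A v.
Proof. by rewrite in_anc fconnect1. Qed.

Lemma ancP v w : reflect (exists i, w = iter i par v) (w \in A v).
Proof.
rewrite in_anc; apply: (iffP idP) => [/iter_findex <-|[i ->]]; last exact: fconnect_iter.
by eexists.
Qed.

Lemma ancS v : A v = v |: A (par v).
Proof.
apply/setP=> w; rewrite in_setU1; apply/idP/orP=> [/ancP[[|i] ->]|[/eqP->|]].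
- by left.
- by right; apply/ancP; exists i; rewrite iterSr.
- exact: anc_refl.
- by move/anc_trans; apply; apply: anc_par.
Qed.

Lemma iter_root i : iter i par r = r.
Proof. by elim: i => //= i ->. Qed.

Lemma anc_r : A r = [set r].
Proof.
apply/setP=> w; rewrite in_set1; apply/ancP/eqP=> [[i ->]|->]; first exact: iter_root.
by exists 0.
Qed.

(* A vertex on a cycle of [par] could not reach the fixed point [r]. *)
Lemma par_notin v : v != r -> v \notin A (par v).
Proof.
apply: contraNN => /ancP[i def_v]; have: r \in A v by rewrite anc_root.
case/ancP=> k def_r; have cyc j : iter (j * i.+1) par v = v.
  by elim: j => // j IHj; rewrite mulSn iterD IHj iterSr -def_v.
by rewrite -(cyc k) mulnS addnC iterD -def_r iter_root.
Qed.

Lemma anc_anti u v : u \in A v -> v \in A u -> u = v.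
Proof.
have [-> | ur] := eqVneq u r; first by rewrite anc_r => _ /set1P.
rewrite ancS in_setU1 => uv /[1!ancS]; rewrite in_setU1 eq_sym => /predU1P[// | vu].
case/predU1P: uv => // uv; case/negP: (par_notin ur).
by apply: anc_trans vu; apply: anc_trans uv (anc_par v).
Qed.

Lemma anc_chain u v w : u \in A w -> v \in A w -> (u \in A v) || (v \in A u).
Proof.
case/ancP=> i -> /ancP[j ->]; case/orP: (leq_total i j) => [le | le]; apply/orP; [right|left];
  by apply/ancP; rewrite -(subnK le) iterD; eexists.
Qed.

Lemma card_ancS v : v != r -> #|A v| = #|A (par v)|.+1.
Proof. by move=> vr; rewrite ancS cardsU1 par_notin. Qed.

(** The symmetric difference consists of the vertices whose parent edge lies on the path from [u] to
    [v], so in a rooted tree this is the distance ([dist_anc]). *)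
Definition sdiff u v := #|A u :\: A v| + #|A v :\: A u|.

Lemma sdiffC u v : sdiff u v = sdiff v u.
Proof. exact: addnC. Qed.

Lemma sdiff_par u v : u \notin A v -> sdiff u v = (sdiff (par u) v).+1.
Proof.
move=> uv; have ur: u != r by apply: contraNneq uv => ->; apply: anc_root.
rewrite /sdiff [A u]ancS setDUl (setDidPl _); last by rewrite disjoints1.
rewrite setDUr (setDidPl _ : A v :\ u = _) ?disjoints1; last first.
  by rewrite disjoint_sym disjoints1.
rewrite (setIidPr (subsetDl _ _)) cardsU1 inE (negPf (par_notin ur)) andbF.
by rewrite add1n addSn.
Qed.

Lemma sdiff_le_par u v : sdiff u v <= (sdiff (par u) v).+1.
Proof.
rewrite /sdiff [A u]ancS setDUl setDUr -addSn leq_add //.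
  apply: leq_trans (leq_card_setU _ _) _; rewrite -add1n leq_add2r.
  by apply: leq_trans (subset_leq_card (subsetDl _ _)) _; rewrite cards1.
exact/subset_leq_card/subsetIr.
Qed.

Lemma sdiff_par_le u v : sdiff (par u) v <= (sdiff u v).+1.
Proof.
rewrite /sdiff [A u]ancS -addnS leq_add //.
  exact/subset_leq_card/setSD/subsetUr.
rewrite -add1n -(cards1 u); apply: leq_trans (leq_card_setU _ _).
by apply/subset_leq_card/subsetP=> w; rewrite !inE; case: (w == u).
Qed.

Lemma sdiff_refl u : sdiff u u = 0.
Proof. by rewrite /sdiff setDv cards0. Qed.

(** One indicator per parent edge: the form in which the sum over pairs can be exchanged with the
    sum over edges. *)
Lemma sdiff_sum u v :
  sdiff u v = \sum_w ((w \in A u) && (w \notin A v) + (w \in A v) && (w \notin A u)).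
Proof.
rewrite /sdiff -!sum1_card big_mkcond [X in _ + X]big_mkcond -big_split /=.
by apply: eq_bigr => w _; rewrite !inE andbC [in X in _ + X]andbC; do 2 case: ifP.
Qed.

Lemma sdiff_cardI u v : sdiff u v + #|A u :&: A v|.*2 = #|A u| + #|A v|.
Proof.
by rewrite -(cardsID (A v) (A u)) -(cardsID (A u) (A v)) (setIC (A v)) /sdiff; lia.
Qed.

End Ancestors.

(** * Distances in a rooted tree *)

Section RootedDist.
Variables (G : sgraph) (r : G) (par : G -> G).
Hypothesis root_par : rooted r par.
Implicit Types u v w : G.
Local Notation A := (anc par).

Let par_r : par r = r. Proof. by case: root_par. Qed.
Let reach v : fconnect par v r. Proof. by case: root_par. Qed.

Lemma adj_par v : v != r -> adj v (par v).
Proof.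
case: root_par => _ _ -> vr; rewrite eqxx orbT andbT.
by apply: contraNneq (par_notin par_r reach vr) => <-; apply: anc_refl.
Qed.

Lemma connect_anc u v : connect (@adj G) u v.
Proof.
have to_r w : connect (@adj G) w r.
  have [n] := ubnP #|A w|; elim: n w => // n IHn w.
  have [-> | wr] := eqVneq w r; first by rewrite connect0.
  rewrite (card_ancS par_r reach wr) => /IHn; apply: connect_trans.
  exact/connect1/adj_par.
by apply: connect_trans (to_r u) _; rewrite (sym_connect_sym (@adj_sym G)).
Qed.

(** [sdiff] changes by at most one along an edge, so no walk is shorter. Conversely, a vertex that
    is not an ancestor of the other can be replaced by its parent, which lowers [sdiff] by exactly
    one and so builds a path of this length. *)
Lemma dist_anc u v : dist u v = sdiff par u v.
Proof.
apply/eqP; rewrite eqn_leq; apply/andP; split; last first.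
  have [p [up <- <-]] := dist_path (connect_anc u v).
  elim: p u up => [|w p IHp] u /=; first by rewrite sdiff_refl.
  case/andP=> uw /IHp /= le_p; apply: leq_trans (_ : (sdiff par w (last w p)).+1 <= _) => //.
  case: root_par uw => _ _ -> /andP[_ /orP[]/eqP->]; first exact: sdiff_par_le.
  exact: sdiff_le_par.
suff [p [up <- <-]]: exists p, [/\ path (@adj G) u p, last u p = v & size p = sdiff par u v].
  exact: dist_le_size.
have [n] := ubnP (sdiff par u v); elim: n u v => // n IHn u v; rewrite ltnS => le_n.
have [uv | uv] := boolP (u \in A v); last first.
  have ur: u != r by apply: contraNneq uv => ->; apply: anc_root.
  rewrite (sdiff_par par_r reach uv) in le_n *.
  have [p [up lp sp]] := IHn _ _ le_n.
  by exists (par u :: p); split=> //=; rewrite ?adj_par ?sp.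
have [vu | vu] := boolP (v \in A u).
  by rewrite (anc_anti par_r reach uv vu); exists [::]; rewrite sdiff_refl.
have vr: v != r by apply: contraNneq vu => ->; apply: anc_root.
rewrite sdiffC (sdiff_par par_r reach vu) in le_n *.
have [|p [up lp sp]] := IHn u (par v); first by rewrite sdiffC.
exists (rcons p v); rewrite rcons_path last_rcons size_rcons up lp adj_sym adj_par //.
by rewrite sp sdiffC.
Qed.

Lemma dist_sym u v : dist u v = dist v u.
Proof. by rewrite !dist_anc sdiffC. Qed.

Lemma dist_root v : (dist r v).+1 = #|A v|.
Proof.
have:= sdiff_cardI par r v; rewrite (anc_r par_r) cards1 dist_anc.
by rewrite (setIidPl _) ?cards1 ?sub1set ?anc_root //; lia.
Qed.

(** On a cycle, both neighbours of a vertex of greatest depth would have to be its parent. *)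
Lemma rooted_is_tree : is_tree G.
Proof.
split; first by split=> [|u v]; [apply/card_gt0P; exists r | apply: connect_anc].
move=> c ucyc_c; rewrite leqNgt; apply/negP=> gt2.
have [w0 w0c]: exists w0, w0 \in c by case: c {ucyc_c} gt2 => // a c _; exists a; apply: mem_head.
case: (@arg_maxnP _ w0 (mem c) (fun w => #|A w|) w0c) => w wc max_w.
have [i p def_c] := rot_to wc.
have: ucycle (@adj G) (w :: p) by rewrite -def_c rot_ucycle.
have memc: w :: p =i c by move=> z; rewrite -def_c mem_rot.
have sz : size (w :: p) > 2 by rewrite -def_c size_rot.
have up z : z \in c -> adj w z -> z = par w.
  move=> /max_w /= le_z; case: root_par => _ _ -> /andP[neq /orP[]/eqP // def_w].
  have zr: z != r by apply: contraNneq neq => z_r; rewrite def_w z_r par_r eqxx.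
  by rewrite (card_ancS par_r reach zr) -def_w ltnn in le_z.
case: p memc sz {def_c} => [|a p] // memc; case/lastP: p memc => [|p b] // memc _.
rewrite /ucycle /= rcons_path last_rcons => /andP[/and3P[wa _ bw]].
rewrite mem_rcons !inE => /and3P[_ /norP[ab _] _].
have ac: a \in c by rewrite -memc !inE eqxx orbT.
have bc: b \in c by rewrite -memc !inE mem_rcons mem_head !orbT.
have wb: adj w b by rewrite adj_sym.
by rewrite (up a ac wa) (up b bc wb) eqxx in ab.
Qed.

End RootedDist.

(** * The five indices in terms of the Wiener index *)

Lemma sum_pairs_double (T : finType) (F : T -> T -> nat) :
  (forall x y, F x y = F y x) ->
  \sum_x \sum_y F x y = (sum_pairs F).*2 + \sum_x F x x.
Proof.
move=> symF.
have swap: sum_pairs F = \sum_x \sum_(y | enum_rank y < enum_rank x) F x y.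
  rewrite /sum_pairs (exchange_big_dep xpredT) //=.
  by apply: eq_bigr => x _; apply: eq_bigr => y _; apply: symF.
rewrite -addnn {2}swap /sum_pairs -!big_split /=.
apply: eq_bigr => x _; rewrite (bigD1 x) //= addnC; congr (_ + _).
rewrite (bigID (fun y => enum_rank x < enum_rank y)) /=; congr (_ + _).
  apply: eq_bigl => y; rewrite andb_idl // => lt_xy.
  by apply: contraTneq lt_xy => ->; rewrite ltnn.
apply: eq_bigl => y; rewrite -leqNgt ltn_neqAle; congr (_ && _).
by rewrite -(inj_eq enum_rank_inj) -(inj_eq val_inj).
Qed.

Lemma dist_le_card (G : sgraph) (u v : G) : dist u v <= #|G|.
Proof. by rewrite -[leqRHS](size_iota 0 #|G|) find_size. Qed.

(** * Distances between edges, and in the line graph *)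

Section EdgeDist.
Variable G : sgraph.
Implicit Types (e f g : edge G) (x y z : G).

Lemma edge_ends e : exists a b, adj a b /\ val e = [set a; b].
Proof.
have /imsetP[[a b]] := valP e; rewrite inE /= => ab ->.
by exists a, b.
Qed.

Lemma edge_adj e x y : x \in val e -> y \in val e -> x != y -> adj x y.
Proof.
case: (edge_ends e) => a [b [ab ->]] /set2P[]-> /set2P[]->; rewrite ?eqxx //.
by rewrite adj_sym.
Qed.

Lemma adj_edge x y : adj x y -> [set x; y] \in edges G.
Proof. by move=> xy; apply/imsetP; exists (x, y); rewrite ?inE. Qed.

Lemma dist_ee_le e f x y : x \in val e -> y \in val f -> dist_ee e f <= dist x y.
Proof.
by move=> xe yf; apply: leq_trans (bigmin_le _ _ xe) (bigmin_le _ _ yf).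
Qed.

Lemma dist_ee_attained e f :
  exists x y, [/\ x \in val e, y \in val f & dist x y = dist_ee e f].
Proof.
have [a [b [_ def_e]]] := edge_ends e; have [c [d [_ def_f]]] := edge_ends f.
have dve x : dist_ve x f = minn (dist x c) (dist x d).
  by rewrite /dist_ve def_f bigmin_set2 ?dist_le_card.
have: dist_ee e f = minn (dist_ve a f) (dist_ve b f).
  by rewrite /dist_ee def_e bigmin_set2 ?bigmin_le_idx.
rewrite !dve /minn; do !case: ifP => _; move=> ->;
  by do 2 eexists; split; rewrite ?def_e ?def_f; last reflexivity;
     rewrite ?set21 ?set22.
Qed.

Lemma dist_ee_refl e : dist_ee e e = 0.
Proof.
have [a [b [_ def_e]]] := edge_ends e; apply/eqP.
by rewrite -leqn0 -(dist_refl a) dist_ee_le // def_e set21.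
Qed.

Hypothesis symG : forall x y, dist x y = dist y x.
Hypothesis connG : forall x y, connect (@adj G) x y.

Lemma dist_ee_sym e f : dist_ee e f = dist_ee f e.
Proof.
wlog suff: e f / dist_ee e f <= dist_ee f e.
  by move=> W; apply/eqP; rewrite eqn_leq !W.
have [x [y [xf ye <-]]] := dist_ee_attained f e.
by rewrite symG dist_ee_le.
Qed.

(** Consecutive edges of a line walk share a vertex, and moving to the shared vertex costs at most
    one step. *)
Lemma line_path_end g p z : path (@line_adj G) g p -> z \in val g ->
  exists2 y, y \in val (last g p) & dist z y <= size p.
Proof.
elim: p g z => [|g' p IHp] g z /=; first by exists z; rewrite ?dist_refl.
case/andP=> /andP[_ /set0Pn[z']]; rewrite inE => /andP[z'g z'g'] g'p zg.
have [y yl le_y] := IHp g' z' g'p z'g'; exists y => //.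
have [-> | zz'] := eqVneq z z'; first exact: leqW.
rewrite symG; apply: leq_trans (_ : (dist y z').+1 <= _).
  by apply: dist_adj (connG _ _) (edge_adj z'g zg _); rewrite eq_sym.
by rewrite ltnS symG.
Qed.

(** The line walk runs through [e], the edges of the given walk and [f]; equal consecutive edges are
    merged, hence an inequality on the length. *)
Lemma line_path e f x p : x \in val e -> path (@adj G) x p -> last x p \in val f ->
  exists q, [/\ path (@line_adj G) e q, last e q = f & size q <= (size p).+1].
Proof.
have lazy (g h : edge G) z : z \in val g -> z \in val h -> g != h -> line_adj g h.
  move=> zg zh gh; rewrite /line_adj gh; apply/set0Pn; exists z.
  by rewrite inE zg.
elim: p e x => [|y p IHp] e x xe /=.
  move=> _ xf; have [-> | ef] := eqVneq e f; first by exists [::].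
  by exists [:: f]; rewrite /= (lazy _ _ x).
case/andP=> xy yp lf.
pose g : edge G := Sub [set x; y] (adj_edge xy).
have [|q [gq lq sq]] := IHp g y _ yp lf; first by rewrite set22.
have [-> | eg] := eqVneq e g; first by exists q; split=> //; apply: leqW.
by exists (g :: q); split=> //=; rewrite gq (lazy _ _ x) ?set21.
Qed.

Lemma dist_lineE e f : dist_line e f = if e == f then 0 else (dist_ee e f).+1.
Proof.
case: eqP => [-> | /eqP ef]; first exact: dist_refl.
have [x [y [xe yf dxy]]] := dist_ee_attained e f.
have [p [xp lp sp]] := dist_path (connG x y).
have [|q [eq lq sq]] := @line_path e f x p xe xp; first by rewrite lp.
have le: dist_line e f <= (dist_ee e f).+1.
  have:= @dist_le_size (line_graph G) e q eq; rewrite lq -dxy -sp => /leq_trans.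
  exact.
apply/eqP; rewrite eqn_leq le /= /dist_line.
have cef: connect (@line_adj G) e f by apply/connectP; exists q.
case: (@dist_path (line_graph G) e f cef) => [[|g p']] [/= ep' lp' <-].
  by rewrite lp' eqxx in ef.
(* The first step of the line walk is free: the vertex shared with the next edge already lies on
   [e]. This accounts for the successor in the formula. *)
case/andP: ep' => /andP[_ /set0Pn[z]]; rewrite inE => /andP[ze zg] gp'.
have [t tl le_t] := line_path_end gp' zg.
by rewrite ltnS; apply: leq_trans le_t; apply: dist_ee_le; rewrite // -lp'.
Qed.

End EdgeDist.

(** * Sums over the edges of a rooted tree *)

Section RootedSums.
Variables (G : sgraph) (r : G) (par : G -> G).
Hypothesis root_par : rooted r par.
Implicit Types u v w : G.
Local Notation A := (anc par).

Let par_r : par r = r. Proof. by case: root_par. Qed.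
Let reach v : fconnect par v r. Proof. by case: root_par. Qed.

Lemma par_edge_inj : {in [set~ r] &, injective (fun w => [set w; par w])}.
Proof.
move=> u v _ _ eq_uv; have := set21 u (par u); rewrite eq_uv => /set2P[] // def_u.
have := set21 v (par v); rewrite -eq_uv => /set2P[] // def_v.
by apply: (anc_anti par_r reach); [rewrite def_u | rewrite def_v]; apply: anc_par.
Qed.

Lemma edgesE : edges G = [set [set w; par w] | w in [set~ r]].
Proof.
case: (root_par) => _ _ adjE; apply/setP=> e; apply/imsetP/imsetP=> [[[a b]]|[w]].
  rewrite inE /= adjE => /andP[neq /orP[]/eqP def] ->.
    exists b; last by rewrite -def setUC.
    by rewrite !inE; apply: contraNneq neq => br; rewrite def br par_r.
  exists a; last by rewrite -def.
  by rewrite !inE; apply: contraNneq neq => ar; rewrite def ar par_r.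
by rewrite !inE => /(adj_par root_par) wp ->; exists (w, par w); rewrite ?inE.
Qed.

Lemma edge_parP (e : edge G) : exists2 w, w != r & val e = [set w; par w].
Proof.
have: val e \in edges G by apply: valP.
by move: (val e) => e0; rewrite edgesE => /imsetP[w]; rewrite !inE; exists w.
Qed.

(** Every edge is the parent edge of exactly one non-root vertex, so edge sums become vertex
    sums. *)
Lemma sum_edges (F : {set G} -> nat) :
  \sum_(e : edge G) F (val e) = \sum_(w | w != r) F [set w; par w].
Proof.
rewrite -(big_sub (mem (edges G))) /= edgesE big_imset /=; last exact: par_edge_inj.
by apply: eq_bigl => w; rewrite !inE.
Qed.

Lemma card_edge : #|edge G| = #|G|.-1.
Proof.
have := sum_edges (fun=> 1); rewrite !sum1_card cardC1.
by rewrite (eq_card (B := edge G)).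
Qed.


(** The parent edge of a non-root [w] counts once in the degree of [w] and once in that of
    [par w]. *)
Lemma sum_deg (F : G -> nat) :
  \sum_v deg v * F v = \sum_(w | w != r) (F w + F (par w)).
Proof.
case: (root_par) => _ _ adjE.
have degE v : deg v = \sum_w (((w == par v) && (v != r)) + ((v == par w) && (w != r))).
  rewrite /deg -sum1_card big_mkcond; apply: eq_bigr => w _; rewrite inE adjE.
  have [-> | vr] := eqVneq v r; have [-> | wr] := eqVneq w r.
  - by rewrite !andbF ?eqxx.
  - by rewrite par_r (negPf wr) orbF; case: (r == par w).
  - by rewrite par_r (negPf vr); case: (r == par v).
  rewrite !andbT; have [vw | nvw] := eqVneq v w.
    subst w; have: v != par v.
      by apply: contraNneq (par_notin par_r reach vr) => <-; apply: anc_refl.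
    by move/negPf->.
  have [eq_w | _] := eqVneq w (par v); have [eq_v | _] := eqVneq v (par w) => //.
  by case/eqP: nvw; apply: (anc_anti par_r reach); [rewrite eq_v | rewrite eq_w]; apply: anc_par.
under eq_bigr do rewrite degE big_distrl /=.
under eq_bigr do (under eq_bigr do rewrite mulnDl; rewrite big_split /=).
rewrite !big_split /=; congr (_ + _).
  rewrite [RHS]big_mkcond; apply: eq_bigr => v _.
  rewrite (bigD1 (par v)) //= eqxx big1 => [|w /negPf->] //.
  by rewrite addn0; case: ifP => _; rewrite ?mul1n.
rewrite exchange_big [RHS]big_mkcond; apply: eq_bigr => w _ /=.
rewrite (bigD1 (par w)) //= eqxx big1 => [|v /negPf->] //.
by rewrite addn0; case: ifP => _; rewrite ?mul1n.
Qed.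

Lemma sum_edge_ends (F : G -> nat) :
  \sum_(w | w != r) (F w + F (par w)) = \sum_(e : edge G) \sum_(x in val e) F x.
Proof.
rewrite (sum_edges (fun e => \sum_(x in e) F x)); apply: eq_bigr => w wr.
rewrite big_setU1 ?big_set1 // inE.
by apply: contraNneq (par_notin par_r reach wr) => <-; apply: anc_refl.
Qed.

Lemma dist_root_par w : w != r -> dist r w = (dist r (par w)).+1.
Proof.
move=> wr; apply: succn_inj.
by rewrite !(dist_root root_par) (card_ancS par_r reach wr).
Qed.

Lemma sum_dist_ve_root : \sum_(e : edge G) dist_ve r e = \sum_(w | w != r) dist r (par w).
Proof.
rewrite (sum_edges (fun e => \big[minn/#|G|]_(x in e) dist r x)).
apply: eq_bigr => w wr; rewrite bigmin_set2 ?dist_le_card //.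
by rewrite dist_root_par // minnC; apply/minn_idPl; rewrite leqnSn.
Qed.

Lemma sum_dist_root :
  \sum_v dist r v = \sum_(w | w != r) dist r (par w) + #|G|.-1.
Proof.
rewrite (bigD1 r) //= dist_refl add0n (eq_bigr _ dist_root_par).
under eq_bigr do rewrite -addn1.
by rewrite big_split /= sum1_card cardC1.
Qed.

Lemma sum_deg_dist_root :
  \sum_v deg v * dist r v = (\sum_(w | w != r) dist r (par w)).*2 + #|G|.-1.
Proof.
rewrite sum_deg; under eq_bigr => w wr do rewrite dist_root_par // -addn1 addnAC addnn.
rewrite big_split /= sum1_card cardC1; congr (_ + _).
by rewrite -muln2 big_distrl /=; apply: eq_bigr => w _; rewrite muln2.
Qed.

Lemma dist_child (b v : G) : b != r -> par b = r ->
  dist b v = if b \in A v then (dist r v).-1 else (dist r v).+1.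
Proof.
move=> br pb; rewrite !(dist_anc root_par).
have ancb : A b = [set b; r] by rewrite ancS pb anc_r.
case: ifP => [bv | /negbT bv]; last first.
  by rewrite (sdiff_par par_r reach bv) pb.
have sub_b: A b \subset A v by rewrite -anc_sub.
have sub_r: A r \subset A v by rewrite -anc_sub anc_root.
have := sdiff_cardI par b v; have := sdiff_cardI par r v.
rewrite (setIidPl sub_b) (setIidPl sub_r) ancb anc_r // cards2 cards1 br /=.
by lia.
Qed.

(* Two distinct edges of a tree lie on a common path, so the four distances
   between their ends average d(e,f) + 1. *)
Lemma dist_ee_four (e f : edge G) b : b != r -> val e = [set r; b] -> e != f ->
  4 * (dist_ee e f).+1 = \sum_(y in val f) (dist r y + dist b y).
Proof.
move=> br def_e ef; case: (root_par) => _ _ adjE.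
have pb: par b = r.
  have := edge_adj (e := e) (x := r) (y := b); rewrite def_e set21 set22 eq_sym br.
  rewrite adjE eq_sym br par_r (negPf br) orbF => H.
  by symmetry; apply/eqP/H.
have [w wr def_f] := edge_parP f.
have wb: w != b.
  apply: contra_neq ef => wb; apply: val_inj.
  by rewrite def_e def_f wb pb setUC.
have wpw: w != par w by apply: contraNneq (par_notin par_r reach wr) => <-; apply: anc_refl.
have dvf x : dist_ve x f = minn (dist x w) (dist x (par w)).
  by rewrite /dist_ve def_f bigmin_set2 ?dist_le_card.
rewrite /dist_ee def_e bigmin_set2 ?bigmin_le_idx // !dvf def_f.
rewrite big_setU1 ?inE // big_set1 !(dist_child _ br pb) [A w]ancS in_setU1 eq_sym (negPf wb) /=.
rewrite (dist_root_par wr); have := dist_root root_par (par w).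
case: ifP => [bpw|]; last by lia.
have: 1 < #|A (par w)|.
  have: [set b; r] \subset A (par w) by apply/subsetP=> z /set2P[]->; rewrite ?bpw ?anc_root.
  by move/subset_leq_card; rewrite cards2 br.
by lia.
Qed.

End RootedSums.

(** Twice the Wiener index: ordered pairs avoid both the choice of a representative and a division
    by 2. *)
Definition double_wiener (G : sgraph) : nat := \sum_(u : G) \sum_(v : G) dist u v.

(** * Affine relations between the indices and the Wiener index *)

Section TreeIndices.
Variable G : sgraph.
Hypothesis treeG : is_tree G.
Implicit Types (u v : G) (e f : edge G).

Local Notation n := #|G|.
Local Notation D u := (\sum_(v : G) dist u v).
Local Notation K u := (\sum_(v : G) deg v * dist u v).

Lemma tree_card_gt0 : 0 < n. Proof. by case: treeG => [[]]. Qed.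

Lemma tree_connect u v : connect (@adj G) u v. Proof. by case: treeG => [[]]. Qed.

Lemma tree_dist_sym u v : dist u v = dist v u.
Proof. by have [par rootG] := tree_rooted u treeG; apply: dist_sym rootG u v. Qed.

Lemma tree_card_edge : #|edge G| = n.-1.
Proof.
have /card_gt0P[u _] := tree_card_gt0.
by have [par rootG] := tree_rooted u treeG; apply: card_edge rootG.
Qed.

(** With the tree rooted at [u], the edge above [w] is one step closer to [u] than [w] is. *)
Lemma sum_dist_ve u : \sum_(e : edge G) dist_ve u e + n.-1 = D u.
Proof.
have [par rootG] := tree_rooted u treeG.
by rewrite (sum_dist_ve_root rootG) (sum_dist_root rootG).
Qed.

(** With the tree rooted at [u], the ends of the edge above [w] contribute [2 * dist u w - 1]. *)
Lemma sum_deg_dist u : K u + n.-1 = (D u).*2.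
Proof.
have [par rootG] := tree_rooted u treeG.
by rewrite (sum_deg_dist_root rootG) (sum_dist_root rootG); lia.
Qed.

Lemma sum_deg_edges (F : G -> nat) :
  \sum_(v : G) deg v * F v = \sum_(e : edge G) \sum_(x in val e) F x.
Proof.
have /card_gt0P[u _] := tree_card_gt0.
have [par rootG] := tree_rooted u treeG.
by rewrite (sum_deg rootG) (sum_edge_ends rootG).
Qed.

Lemma tree_sum_deg : \sum_(v : G) deg v = n.-1.*2.
Proof.
have /card_gt0P[u _] := tree_card_gt0.
have [par rootG] := tree_rooted u treeG.
have := sum_deg rootG (fun=> 1); under eq_bigr do rewrite muln1.
by move=> ->; rewrite sum_nat_const cardC1 muln2.
Qed.

(** This sums [dist_ee_four] over [f]. The term [f = e], which that identity excludes, contributes 2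
    instead of 4; hence the correction 2. *)
Lemma sum_dist_ee e : 4 * (\sum_(f : edge G) dist_ee e f) + 4 * n.-1 = \sum_(x in val e) K x + 2.
Proof.
have [a [b [ab def_e]]] := edge_ends e.
have neq_ab: a != b by apply: contraTneq ab => ->; rewrite adj_irr.
have ba: b != a by rewrite eq_sym.
have [par rootG] := tree_rooted a treeG.
have anotin: a \notin [set b] by rewrite inE.
have four f : f != e -> \sum_(y in sval f) (dist a y + dist b y) = 4 * dist_ee e f + 4.
  by rewrite eq_sym => /(dist_ee_four rootG ba def_e) <-; rewrite mulnS addnC.
rewrite def_e big_setU1 //= big_set1 !sum_deg_edges -big_split /=.
under [in RHS]eq_bigr do rewrite -big_split /=.
rewrite (bigD1 e) //= [in RHS](bigD1 e) //= dist_ee_refl add0n (eq_bigr _ four).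
rewrite -[sval e]/(val e).
rewrite def_e big_setU1 //= big_set1 !dist_refl [dist b a]tree_dist_sym.
rewrite big_split /= -big_distrr /= sum_nat_const cardC1 tree_card_edge.
have dab: dist a b = 1.
  have := dist_adj (connect0 _ a) ab; rewrite dist_refl => le1.
  apply/eqP; rewrite eqn_leq le1 lt0n; apply: contraNneq neq_ab => d0.
  by rewrite (dist0_eq _ d0) ?tree_connect.
have: 0 < n.-1 by rewrite -tree_card_edge; apply/card_gt0P; exists e.
rewrite dab; move: (\sum_(i | _) _) #|G| => S [|[|k]] //=; lia.
Qed.

Lemma double_sum_dist_ve : \sum_(u : G) \sum_(e : edge G) dist_ve u e + n * n.-1 = double_wiener G.
Proof.
rewrite /double_wiener -(eq_bigr _ (fun u _ => sum_dist_ve u)) big_split /=.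
by rewrite sum_nat_const.
Qed.

Lemma double_schultz : \sum_(u : G) K u + n * n.-1 = (double_wiener G).*2.
Proof.
rewrite /double_wiener -muln2 big_distrl /=.
under [RHS]eq_bigr do rewrite muln2 -sum_deg_dist.
by rewrite big_split /= sum_nat_const.
Qed.

(** Obtained from [sum_deg_dist], weighted by [deg u] and summed over [u]; the degrees add up to
    [2 * (n - 1)]. *)
Lemma double_gutman : \sum_(u : G) deg u * K u + n.-1 ^ 2 * 2 = (\sum_(u : G) K u).*2.
Proof.
have -> : \sum_(u : G) K u = \sum_(u : G) deg u * D u.
  rewrite exchange_big; apply: eq_bigr => u _; rewrite big_distrr /=.
  by apply: eq_bigr => v _; rewrite tree_dist_sym.
rewrite -muln2 big_distrl /=.
under [RHS]eq_bigr do rewrite -mulnA muln2 -sum_deg_dist mulnDr.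
rewrite big_split /= -big_distrl /= tree_sum_deg; congr (_ + _).
by rewrite -mulnn -muln2 mulnAC.
Qed.

Lemma double_edge_wiener :
  4 * (\sum_(e : edge G) \sum_(f : edge G) dist_ee e f) + 4 * n.-1 ^ 2 =
    \sum_(u : G) deg u * K u + n.-1.*2.
Proof.
have: \sum_(e : edge G) (4 * (\sum_(f : edge G) dist_ee e f) + 4 * n.-1) =
      \sum_(e : edge G) (\sum_(x in val e) K x + 2) by apply: eq_bigr => e _; apply: sum_dist_ee.
rewrite sum_deg_edges big_split [X in _ = X -> _]big_split /= !sum_nat_const.
rewrite tree_card_edge muln2 => <-.
by rewrite -big_distrr /= mulnCA mulnn.
Qed.

Lemma double_edge_wiener_line :
  \sum_(e : edge G) \sum_(f : edge G) dist_line e f + n.-1 =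
    \sum_(e : edge G) \sum_(f : edge G) dist_ee e f + n.-1 ^ 2.
Proof.
have line e : \sum_(f : edge G) dist_line e f + 1 = \sum_(f : edge G) dist_ee e f + n.-1.
  rewrite (bigD1 e) //= [in RHS](bigD1 e) //= dist_ee_refl.
  rewrite (dist_lineE tree_dist_sym tree_connect) eqxx !add0n.
  under eq_bigr => f fe.
    rewrite (dist_lineE tree_dist_sym tree_connect) eq_sym (negPf fe) -addn1.
  over.
  rewrite big_split /= sum_nat_const cardC1 tree_card_edge.
  have: 0 < n.-1 by rewrite -tree_card_edge; apply/card_gt0P; exists e.
  by move: (\sum_(f | _) _) #|G| => S [|[|k]] //=; lia.
have/(_ 0 addn (index_enum _) xpredT) := eq_bigr _ (fun e _ => line e).
by rewrite !big_split /= !sum_nat_const tree_card_edge muln1 -mulnn.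
Qed.

Lemma double_sum_pairs (T : finType) (F : T -> T -> nat) :
  (forall x y, F x y = F y x) -> (forall x, F x x = 0) ->
  (sum_pairs F).*2 = \sum_x \sum_y F x y.
Proof. by move=> /sum_pairs_double-> F0; rewrite [X in _ + X]big1 ?addn0. Qed.

(** Coefficients of the relation [2 * I + index_shift = index_scale * double_wiener]. In terms of
    the Wiener index W this says W_e = W - (n-1)^2, W'_e = W_ve = W - n(n-1)/2, W_+ = 4W - n(n-1)
    and W_- = 4W - (n-1)(2n-1). *)
Definition index_scale (I : top_index) : nat :=
  match I with EdgeWienerLine | EdgeWiener | VertexEdgeWiener => 1 | _ => 4 end.

Definition index_shift (I : top_index) (k : nat) : nat :=
  match I with
  | EdgeWienerLine | VertexEdgeWiener => k * k.-1
  | EdgeWiener => 2 * k.-1 ^ 2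
  | Schultz => 2 * (k * k.-1)
  | Gutman => 2 * (k.-1 * (2 * k).-1)
  end.

Lemma double_wiener_relations :
  [/\ (\sum_(u : G) K u).*2 + index_shift Schultz n = 4 * double_wiener G,
      \sum_(u : G) deg u * K u + index_shift Gutman n = 4 * double_wiener G,
      \sum_(e : edge G) \sum_(f : edge G) dist_ee e f + index_shift EdgeWiener n
        = double_wiener G
    & \sum_(e : edge G) \sum_(f : edge G) dist_line e f + index_shift EdgeWienerLine n
        = double_wiener G].
Proof.
have := double_edge_wiener_line; have := double_edge_wiener.
have := double_gutman; have := double_schultz; have := tree_card_gt0.
move: (\sum_u K u) (\sum_u deg u * _) (\sum_e \sum_f dist_ee e f) => X Y Z.
move: (\sum_e \sum_f _) (double_wiener G) n => L H [//|k] _; rewrite /index_shift /= -!mulnn.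
by split; nia.
Qed.

Lemma index_valE (I : top_index) :
  (2%:R * index_val I G + (index_shift I n)%:R =
   (index_scale I * double_wiener G)%:R :> rat)%R.
Proof.
have := double_wiener_relations.
case: I => /=; rewrite ?GRing.mulVKf // -?GRing.natrM -?GRing.natrD => rel; congr (_%:R)%R.
- have sp : (sum_pairs (@dist_line G)).*2 = \sum_(e : edge G) \sum_(f : edge G) dist_line e f.
    apply: double_sum_pairs => [e f | e]; rewrite !(dist_lineE tree_dist_sym tree_connect).
      by rewrite eq_sym dist_ee_sym //; apply: tree_dist_sym.
    by rewrite eqxx.
  by case: rel => _ _ _ <-; rewrite mul1n mul2n sp.
- rewrite mul2n (double_sum_pairs (dist_ee_sym tree_dist_sym) (@dist_ee_refl G)) mul1n.
  by case: rel.
- by rewrite mul1n double_sum_dist_ve.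
- have := @double_sum_pairs G (fun u v => dist u v * (deg u + deg v)).
  have -> : \sum_(u : G) \sum_(v : G) dist u v * (deg u + deg v) = (\sum_(u : G) K u).*2.
    rewrite -addnn [X in _ = _ + X]exchange_big -big_split; apply: eq_bigr => u _ /=.
    rewrite -big_split; apply: eq_bigr => v _ /=.
    by rewrite tree_dist_sym mulnDr addnC !(mulnC (dist v u)).
  move=> sp; rewrite mul2n sp => [|u v|u]; last 2 first.
  - by rewrite tree_dist_sym addnC.
  - by rewrite dist_refl.
  by case: rel.
- have := @double_sum_pairs G (fun u v => dist u v * (deg u * deg v)).
  have -> : \sum_(u : G) \sum_(v : G) dist u v * (deg u * deg v) = \sum_(u : G) deg u * K u.
    apply: eq_bigr => u _; rewrite big_distrr; apply: eq_bigr => v _ /=.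
    by rewrite mulnC -mulnA [deg v * _]mulnC.
  move=> sp; rewrite mul2n sp => [|u v|u]; last 2 first.
  - by rewrite tree_dist_sym (mulnC (deg u)).
  - by rewrite dist_refl.
  by case: rel.
Qed.

End TreeIndices.

Lemma index_val_le (I : top_index) (G H : sgraph) :
  is_tree G -> is_tree H -> #|G| = #|H| ->
  (index_val I G <= index_val I H)%R = (double_wiener G <= double_wiener H).
Proof.
move=> tG tH eq_n.
rewrite -(Num.Theory.ler_pM2l (_ : 0 < 2%:R)%R) //.
rewrite -(Num.Theory.lerD2r (index_shift I #|G|)%:R) {2}eq_n !index_valE //.
by rewrite Num.Theory.ler_nat leq_pmul2l //; case: I.
Qed.

(** * The centre of a tree *)

(* The centre is the vertex r, or the edge between r and c when o holds; x and y
   are the ends of a diametral path of length 2h + o, and lev is the distance to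
   the centre.  When o fails, c is irrelevant. *)
Record centered (G : sgraph) (h : nat) (o : bool) (r c x y : G)
    (par : G -> G) (lev : G -> nat) : Prop := Centered {
  ctr_rooted : rooted r par;
  ctr_lev_par : forall v, lev (par v) = (lev v).-1;
  ctr_lev0 : forall v, lev v = 0 -> v = r \/ o /\ v = c;
  ctr_lev_r : lev r = 0;
  ctr_bicenter : o -> [/\ c != r, lev c = 0, c \in anc par y & c \notin anc par x];
  ctr_lev_x : lev x = h;
  ctr_lev_y : lev y = h;
  ctr_disjoint : anc par x :&: anc par y = [set r] }.

(** * Levels, distances to the ends of the diametral path, eccentricities *)

Section Centered.
Variables (G : sgraph) (h : nat) (o : bool) (r c x y : G).
Variables (par : G -> G) (lev : G -> nat).
Hypothesis ctr : centered h o r c x y par lev.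
Implicit Types u v w z : G.
Local Notation A := (anc par).

Let root_par : rooted r par. Proof. exact: ctr_rooted ctr. Qed.
Let par_r : par r = r. Proof. by case: root_par. Qed.
Let reach v : fconnect par v r. Proof. by case: root_par. Qed.

Lemma lev_iter i v : lev (iter i par v) = lev v - i.
Proof. by elim: i => [|i IHi] /=; rewrite ?subn0 // (ctr_lev_par ctr) IHi -subnS. Qed.

Lemma lev_anc w v : w \in A v -> lev w <= lev v.
Proof. by case/ancP=> i ->; rewrite lev_iter leq_subr. Qed.

Lemma anc_lev w v : w \in A v -> 0 < lev w -> w = iter (lev v - lev w) par v.
Proof.
case/ancP=> i ->; rewrite lev_iter subn_gt0 => lt_i.
by rewrite subKn // ltnW.
Qed.

Lemma anc_lev_inj v : {in A v &, forall w z, 0 < lev w -> lev w = lev z -> w = z}.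
Proof.
move=> w z wv zv lw eq_l; have lz: 0 < lev z by rewrite -eq_l.
by rewrite (anc_lev wv lw) (anc_lev zv lz) eq_l.
Qed.

Lemma anc_le w z v : w \in A v -> z \in A v -> lev w < lev z -> w \in A z.
Proof.
move=> wv zv lt_wz; case/orP: (anc_chain wv zv) => // /lev_anc.
by rewrite leqNgt lt_wz.
Qed.

Lemma card_anc_lev k v : 0 < k -> #|[set w in A v | k <= lev w]| = (lev v).+1 - k.
Proof.
move=> k_gt0; have [n] := ubnP (lev v); elim: n v => // n IHn v; rewrite ltnS => le_n.
have [lt_k | le_k] := ltnP (lev v) k.
  rewrite (_ : [set _ in _ | _] = set0) ?cards0; first by lia.
  apply/setP=> w; rewrite !in_set; apply/negbTE/andP=> -[/lev_anc le_w le_k].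
  by have := leq_trans le_k le_w; rewrite leqNgt lt_k.
have vr: v != r by apply: contraTneq le_k => ->; rewrite (ctr_lev_r ctr) -ltnNge.
have lt_p: lev (par v) < n by rewrite (ctr_lev_par ctr); lia.
rewrite (_ : [set w in A v | _] = v |: [set w in A (par v) | k <= lev w]).
  rewrite cardsU1 IHn // (ctr_lev_par ctr) in_set (negPf (par_notin _ _ vr)) //=; lia.
apply/setP=> w; rewrite in_set ancS !in_setU1 in_set.
by have [-> | _] := eqVneq w v; rewrite ?le_k.
Qed.

Lemma card_anc_eq_lev k v : 0 < k -> #|[set w in A v | lev w == k]| = (k <= lev v).
Proof.
move=> k_gt0; have := card_anc_lev v k_gt0; have := card_anc_lev v (ltn0Sn k).
rewrite -(cardsID [set w | lev w == k] [set w in A v | k <= lev w]).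
rewrite (_ : _ :&: _ = [set w in A v | lev w == k]); last first.
  apply/setP=> w; rewrite !in_set -andbA; congr (_ && _).
  by rewrite andb_idl // => /eqP->.
rewrite (_ : _ :\: _ = [set w in A v | k < lev w]); last first.
  apply/setP=> w; rewrite !in_set ltn_neqAle eq_sym; case: (w \in A v) => //=.
  by rewrite andbF.
by move=> ->; lia.
Qed.

Lemma disj_lev0 w : w \in A x -> w \in A y -> w = r.
Proof. by move=> wx wy; apply/set1P; rewrite -(ctr_disjoint ctr) inE wx. Qed.

Lemma bicenter_par : o -> par c = r.
Proof.
move=> oT; have [cr lc cy cx] := ctr_bicenter ctr oT.
have: lev (par c) = 0 by rewrite (ctr_lev_par ctr) lc.
case/(ctr_lev0 ctr)=> // -[_ pc]; have := par_notin par_r reach cr.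
by rewrite pc anc_refl.
Qed.

(** One ancestor on each level from 0 to [lev v], and a second one of level 0 when [v] lies below
    [c]. *)
Lemma card_anc v : #|A v| = (lev v).+1 + (o && (c \in A v)).
Proof.
rewrite -(cardsID [set w | 0 < lev w]) (_ : _ :&: _ = [set w in A v | 0 < lev w]); last first.
  by apply/setP=> w; rewrite !in_set.
rewrite card_anc_lev // subn1 /= addSnnS; congr (_ + _).
have [/andP[oT cv] | noc] := boolP (o && (c \in A v)).
  have [cr lc _ _] := ctr_bicenter ctr oT.
  rewrite (_ : _ :\: _ = [set r; c]) ?cards2 1?eq_sym ?cr //.
  apply/setP=> w; rewrite !inE -leqNgt leqn0; apply/andP/orP=> [[lw wv]|].
    by case: (ctr_lev0 ctr (eqP lw)) => [->|[_ ->]]; rewrite eqxx; [left|right].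
  by case=> /eqP->; rewrite ?(ctr_lev_r ctr) ?lc ?eqxx ?cv // (anc_root reach).
rewrite (_ : _ :\: _ = [set r]) ?cards1 //.
apply/setP=> w; rewrite !inE -leqNgt leqn0; apply/andP/eqP=> [[lw wv]|->].
  by case: (ctr_lev0 ctr (eqP lw)) => // -[oT wc]; rewrite oT -wc wv in noc.
by rewrite (ctr_lev_r ctr) (anc_root reach).
Qed.

Lemma dist_card_anc u v : dist u v + #|A u :&: A v|.*2 = #|A u| + #|A v|.
Proof. by rewrite (dist_anc root_par) sdiff_cardI. Qed.

Lemma anc_cap_root u v : r \in A u :&: A v.
Proof. by rewrite inE !(anc_root reach). Qed.

Lemma card_cap_gt0 u v : 0 < #|A u :&: A v|.
Proof. by apply/card_gt0P; exists r; apply: anc_cap_root. Qed.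

Lemma card_cap_gt1 u v w : w \in A u -> w \in A v -> w != r -> 1 < #|A u :&: A v|.
Proof.
move=> wu wv wr; have: [set w; r] \subset A u :&: A v.
  by apply/subsetP=> z /set2P[]->; rewrite ?anc_cap_root // inE wu.
by move/subset_leq_card; rewrite cards2 wr.
Qed.

Lemma dist_le_lev u v : dist u v <= lev u + lev v + o.
Proof.
have := dist_card_anc u v; have := card_cap_gt0 u v; rewrite !card_anc.
have [oT | _] /= := boolP o; last by lia.
have [cr _ _ _] := ctr_bicenter ctr oT.
have [cu|cu] := boolP (c \in A u); have [cv|cv] := boolP (c \in A v); try lia.
by have := card_cap_gt1 cu cv cr; lia.
Qed.

Lemma dist_far u v : A u :&: A v = [set r] ->
  dist u v = lev u + lev v + (o && (c \in A u)) + (o && (c \in A v)).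
Proof. by move=> cap; have := dist_card_anc u v; rewrite cap cards1 !card_anc; lia. Qed.

(** A common ancestor of [v] and [x] of positive level would lie below [c], and so would [x]; only
    the root is common. *)
Lemma dist_far_x v : o -> c \in A v -> dist v x = lev v + h + 1.
Proof.
move=> oT cv; have [cr lc cy cx] := ctr_bicenter ctr oT.
rewrite dist_far; first by rewrite (ctr_lev_x ctr) oT cv (negPf cx) addn0.
apply/eqP; rewrite eqEsubset sub1set anc_cap_root andbT.
apply/subsetP=> w; rewrite in_setI => /andP[wv wx]; apply/set1P.
have [lw | lw] := posnP (lev w).
  by case: (ctr_lev0 ctr lw) => // -[_ wc]; rewrite -wc wx in cx.
by case/negP: cx; apply: anc_trans wx; apply: anc_le cv wv _; rewrite lc.
Qed.

Lemma dist_far_y v : o -> c \notin A v -> dist v y = lev v + h + 1.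
Proof.
move=> oT cv; have [cr lc cy cx] := ctr_bicenter ctr oT.
rewrite dist_far; first by rewrite (ctr_lev_y ctr) oT cy (negPf cv) addn0.
apply/eqP; rewrite eqEsubset sub1set anc_cap_root andbT.
apply/subsetP=> w; rewrite in_setI => /andP[wv wy]; apply/set1P.
have [lw | lw] := posnP (lev w).
  by case: (ctr_lev0 ctr lw) => // -[_ wc]; rewrite -wc wv in cv.
by case/negP: cv; apply: anc_trans wv; apply: anc_le cy wy _; rewrite lc.
Qed.

(** The ancestors of [v] form a chain. If it met both halves of the path outside the root, the upper
    of the two meeting points would be a non-root ancestor of both [x] and [y]. *)
Lemma cap_far v : ~~ o -> A v :&: A x != [set r] -> A v :&: A y = [set r].
Proof.
move=> oF; rewrite eqEsubset sub1set anc_cap_root andbT => /subsetPn[w].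
rewrite in_setI => /andP[wv wx]; rewrite inE => wr.
apply/eqP; rewrite eqEsubset sub1set anc_cap_root andbT.
apply/subsetP=> z; rewrite in_setI => /andP[zv zy]; apply/set1P/eqP.
case/orP: (anc_chain wv zv) => [wz | zw].
  by rewrite (disj_lev0 wx (anc_trans wz zy)) eqxx in wr.
by apply/eqP/disj_lev0; first apply: anc_trans zw wx.
Qed.

Lemma lev0_unicenter v : ~~ o -> lev v = 0 -> v = r.
Proof. by move=> /negPf oF /(ctr_lev0 ctr)[// | []]; rewrite oF. Qed.

Lemma exists_far v : exists2 z, z \in [:: x; y] & dist v z = lev v + h + o.
Proof.
have [oT | oF] := boolP o.
  have [cv | cv] := boolP (c \in A v).
    by exists x; rewrite ?mem_head // dist_far_x.
  by exists y; rewrite ?inE ?eqxx ?orbT // dist_far_y.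
have [cap | cap] := eqVneq (A v :&: A x) [set r].
  by exists x; rewrite ?mem_head // dist_far // (ctr_lev_x ctr) (negPf oF) !addn0.
exists y; rewrite ?inE ?eqxx ?orbT // dist_far ?cap_far //.
by rewrite (ctr_lev_y ctr) (negPf oF) !addn0.
Qed.

Hypothesis lev_le : forall v, lev v <= h.

(** The maximum is attained at an end of the diametral path whose only common ancestor with [v] is
    the root. *)
Lemma ecc_lev v : ecc v = lev v + h + o.
Proof.
apply/eqP; rewrite eqn_leq /ecc; apply/andP; split; last first.
  by have [z _ <-] := exists_far v; apply: leq_bigmax.
apply/bigmax_leqP=> u _; apply: leq_trans (dist_le_lev v u) _.
by rewrite leq_add2r leq_add2l.
Qed.

Lemma near_bicenter v : o -> (dist v x < dist v y) = (c \notin A v).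
Proof.
move=> oT; have [cr lc cy cx] := ctr_bicenter ctr oT.
have dle z : dist v z <= lev v + lev z + 1 by have := dist_le_lev v z; rewrite oT.
have [cv | cv] := boolP (c \in A v).
  by have := dle y; rewrite dist_far_x // (ctr_lev_y ctr); lia.
rewrite dist_far_y //; have := dist_card_anc v x; have := card_cap_gt0 v x.
by rewrite !card_anc (negPf cx) (negPf cv) !andbF (ctr_lev_x ctr) /=; lia.
Qed.

Lemma near_bicenter_y v : o -> (dist v y < dist v x) = (c \in A v).
Proof.
move=> oT; have := near_bicenter v oT; have [cr lc cy cx] := ctr_bicenter ctr oT.
have [cv | cv] := boolP (c \in A v); last by lia.
have := dist_card_anc v y; have := card_cap_gt1 cv cy cr.
by rewrite !card_anc dist_far_x // cy cv andbT oT (ctr_lev_y ctr) /=; lia.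
Qed.

(** Vertices in the branches of neither [x] nor [y] are equidistant from both, so the strict
    comparison singles out the branch of [x] at the root. *)
Lemma near_unicenter v : ~~ o -> (dist v x < dist v y) = (A v :&: A x != [set r]).
Proof.
move=> oF; have dle z : dist v z <= lev v + lev z.
  by have := dist_le_lev v z; rewrite (negPf oF) addn0.
have [cap | cap] := eqVneq (A v :&: A x) [set r].
  rewrite (dist_far cap) (negPf oF) /= !addn0 (ctr_lev_x ctr) -(ctr_lev_y ctr).
  by apply/negbTE; rewrite -leqNgt.
rewrite (dist_far (cap_far oF cap)) (negPf oF) /= !addn0 (ctr_lev_y ctr).
move: cap; rewrite eqEsubset sub1set anc_cap_root andbT => /subsetPn[w].
rewrite in_setI => /andP[wv wx]; rewrite inE => wr.
have := dist_card_anc v x; have := card_cap_gt1 wv wx wr.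
by rewrite !card_anc (negPf oF) /= (ctr_lev_x ctr); lia.
Qed.

End Centered.

Lemma centered_swap (G : sgraph) h (r c x y : G) par lev :
  centered h false r c x y par lev -> centered h false r c y x par lev.
Proof. by case=> *; split; rewrite // setIC. Qed.

(** * Existence of a centre *)

Section Existence.
Variables (G : sgraph).
Hypothesis treeG : is_tree G.
Implicit Types u v w x y : G.

Lemma dist_par r par v : rooted r par -> dist r (par v) = (dist r v).-1.
Proof.
move=> rootG; have [-> | vr] := eqVneq v r; last by rewrite (dist_root_par rootG vr).
by case: rootG => -> _ _; rewrite dist_refl.
Qed.

Lemma dist_iter r par i v : rooted r par -> dist r (iter i par v) = dist r v - i.
Proof.
move=> rootG; elim: i => [|i IHi] /=; first by rewrite subn0.
by rewrite (dist_par _ rootG) IHi subnS.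
Qed.

Lemma dist_split x y i : i <= dist x y -> exists r, dist x r = i /\ dist r y = dist x y - i.
Proof.
move=> le_i; have [par rootG] := tree_rooted x treeG; have [par_x reach _] := rootG.
pose r := iter (dist x y - i) par y.
have ry: r \in anc par y by apply/ancP; exists (dist x y - i).
have xr: dist x r = i by rewrite (dist_iter _ _ rootG) subKn.
exists r; split=> //; have := sdiff_cardI par r y.
rewrite -(dist_anc rootG) (setIidPl _) -?anc_sub //.
by rewrite -!(dist_root rootG) xr; lia.
Qed.

Lemma diameter_centered x y :
    (forall u v, dist u v <= dist x y) ->
  exists r c par lev, centered (dist x y)./2 (odd (dist x y)) r c x y par lev
    /\ forall v, lev v <= (dist x y)./2.
Proof.
set d := dist x y => max_d; pose h := d./2; pose o := odd d.
have def_d: d = h + h + o by rewrite addnn addnC odd_double_half.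
have [|r [xr ry]] := @dist_split x y h; first by rewrite -/d; lia.
have [par rootG] := tree_rooted r treeG; have [par_r reach _] := rootG.
have rx: dist r x = h by rewrite (dist_sym rootG).
have {}ry: dist r y = h + o by rewrite ry -/d; lia.
(* [y] has depth [h + o], so in the odd case this is the child of the root towards [y]. *)
pose c := iter (h + o).-1 par y.
have cy: c \in anc par y by apply/ancP; exists (h + o).-1.
have rc: o -> dist r c = 1 by rewrite (dist_iter _ _ rootG) ry => oT; lia.
have cap: anc par x :&: anc par y = [set r].
  apply/eqP; rewrite eq_sym eqEcard sub1set inE !(anc_root reach) cards1.
  have := sdiff_cardI par x y; rewrite -(dist_anc rootG) -!(dist_root rootG) rx ry -/d.
  by lia.
have cr: o -> c != r by move/rc => rc1; apply: contra_eq_neq rc1 => ->; rewrite dist_refl.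
have cx: o -> c \notin anc par x.
  move/cr; apply: contraNN => cx; have: c \in anc par x :&: anc par y by rewrite inE cx.
  by rewrite cap inE.
(* Below [c] the nearer central vertex is [c], one step closer than the root. *)
pose lev v := dist r v - (o && (c \in anc par v)).
have r0 v : dist r v = 0 -> v = r.
  by move=> /dist0_eq-> //; case: treeG => [[]].
have lev_r: lev r = 0 by rewrite /lev dist_refl.
have ctr: centered h o r c x y par lev.
  split=> //.
  - move=> v; have [-> | vr] := eqVneq v r; first by rewrite par_r lev_r.
    rewrite /lev (dist_par _ rootG) [anc par v]ancS in_setU1.
    have [cv | _] /= := eqVneq c v; last by lia.
    have [oT | _] := boolP o; last by lia.
    by have := rc oT; rewrite cv => ->.
  - move=> v; rewrite /lev => /eqP; rewrite subn_eq0.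
    have [/r0-> | v_gt0] := posnP (dist r v); first by left.
    have [oT | _] /= := boolP o; last by rewrite leqNgt v_gt0.
    have [cv | _] /= := boolP (c \in anc par v); last by rewrite leqNgt v_gt0.
    move=> le1; right; split=> //; move: cv; rewrite ancS in_setU1 => /predU1P[// | ].
    have -> : par v = r by apply: r0; rewrite (dist_par _ rootG); lia.
    by rewrite anc_r // inE (negPf (cr oT)).
  - move=> oT; split=> //; [exact: cr | | exact: cx].
    by rewrite /lev oT anc_refl rc.
  - rewrite /lev rx; have [oT | _] := boolP o; last by rewrite subn0.
    by rewrite (negPf (cx oT)) subn0.
  - by rewrite /lev ry cy andbT addnK.
exists r, c, par, lev; split=> // v.
(* Some end is at distance [lev v + h + o] from [v], which cannot exceed the diameter
   [h + h + o]. *)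
have [z z_in] := exists_far ctr v; have := max_d v z; rewrite def_d => le_d eq_z.
by rewrite eq_z in le_d; lia.
Qed.

(** Compares the weights of the two halves, to decide which end of the diametral path is named
    [y]. *)
Definition nearer x y := #|[set v | dist v x < dist v y]|.

Lemma tree_centered :
  exists h o r c x y par lev, [/\ centered h o r c x y par lev,
    forall v, lev v <= h & nearer x y <= nearer y x].
Proof.
have /card_gt0P[u0 _] := tree_card_gt0 treeG.
have [[x0 y0] _ max0] := @arg_maxnP (G * G)%type (u0, u0) xpredT (fun p => dist p.1 p.2) isT.
wlog le_xy: x0 y0 max0 / nearer x0 y0 <= nearer y0 x0.
  move=> W; case/orP: (leq_total (nearer x0 y0) (nearer y0 x0)); first exact: W.
  by apply: W => p /max0 /=; rewrite [dist y0 x0](tree_dist_sym treeG).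
have max_d u v : dist u v <= dist x0 y0 by apply: (max0 (u, v)).
have [r [c [par [lev [ctr le_h]]]]] := diameter_centered max_d.
by do 8!eexists; split; [apply: ctr | | ].
Qed.

End Existence.

(** * The bound on each level *)

(* The largest sum of squares of m positive integers with sum N of which two are
   at least H. *)
Definition level_bound (H m N : nat) : nat :=
  let E := N - (2 * H + (m - 2)) in 2 * H ^ 2 + (m - 2) + 2 * H * E + E ^ 2.

Section LevelSquares.
Variables (T : finType) (P Z : {set T}) (H : nat) (s : T -> nat).

Definition base w := if w \in Z then H else 1.
Definition excess w := s w - base w.
(** The loss against the extremal configuration. The first term charges excess on a vertex whose
    base is below [H], the second charges excess shared between two vertices of [P]. *)
Definition defect w :=
  2 * (H - base w) * excess w + excess w * \sum_(z in P | z != w) excess z.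

Hypotheses (H_gt0 : 0 < H) (s_ge : forall w, w \in P -> base w <= s w).
Hypothesis PZ : #|P :&: Z| = 2.

Lemma sum_base (F : nat -> nat) : \sum_(w in P) F (base w) = 2 * F H + (#|P| - 2) * F 1.
Proof.
rewrite (bigID (fun w => w \in Z)) /=; congr (_ + _).
  rewrite -PZ -sum_nat_const; apply: eq_big => [w | w /andP[_ wZ]]; first by rewrite inE.
  by rewrite /base wZ.
rewrite -PZ -cardsD -sum_nat_const; apply: eq_big => [w | w /andP[_ /negPf wZ]].
  by rewrite inE andbC.
by rewrite /base wZ.
Qed.

(** Expanding [(base + excess)^2]: the first part of the defect raises the factor [base] of the
    mixed term to [H], the second completes the squares of the excesses to the square of their
    sum. *)
Lemma level_squares :
  level_bound H #|P| (\sum_(w in P) s w) = \sum_(w in P) s w ^ 2 + \sum_(w in P) defect w.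
Proof.
have s_split w : w \in P -> s w = base w + excess w by move/s_ge=> ?; rewrite subnKC.
have base_le w : base w <= H by rewrite /base; case: ifP.
rewrite (eq_bigr _ s_split) big_split /=.
have -> := sum_base id; rewrite /level_bound muln1 addKn.
set E := \sum_(w in P) excess w.
have -> : E ^ 2 = \sum_(w in P) (excess w ^ 2 + excess w * \sum_(z in P | z != w) excess z).
  rewrite -mulnn {1}/E big_distrl /=; apply: eq_bigr => w wP.
  by rewrite /E (bigD1 w wP) /= mulnDr mulnn.
have -> : 2 * H ^ 2 + (#|P| - 2) = \sum_(w in P) base w ^ 2.
  by rewrite (sum_base (fun k => k ^ 2)) exp1n muln1.
rewrite big_distrr -!big_split /=; apply: eq_bigr => w wP.
rewrite {1}(s_split w wP) /defect.
move: (excess w) (base w) (base_le w) (\sum_(z in P | _) _) => e b le_b S.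
by nia.
Qed.

End LevelSquares.

(** The edge above [w] lies on the path between [u] and [v] exactly when one of them is below [w]
    and the other is not. The root gives no term, as every vertex lies below it. *)
Lemma double_wiener_sizes (G : sgraph) (r : G) par : rooted r par ->
  let s w := #|[set v | w \in anc par v]| in
  double_wiener G = 2 * \sum_(w | w != r) s w * (#|G| - s w).
Proof.
move=> rootG s; have [_ reach _] := rootG.
have sC w : #|G| - s w = #|[set v | w \notin anc par v]|.
  rewrite -(cardsC [set v | w \in anc par v]) addKn.
  by apply: eq_card => v; rewrite !inE.
have sr : #|G| - s r = 0.
  by rewrite sC; apply/eqP; rewrite cards_eq0; apply/eqP/setP=> v; rewrite !inE (anc_root reach).
transitivity (2 * \sum_w s w * (#|G| - s w)); last first.
  by rewrite [in LHS](bigD1 r) //= sr muln0.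
rewrite /double_wiener.
under eq_bigr do under eq_bigr do rewrite (dist_anc rootG) sdiff_sum.
under eq_bigr do rewrite exchange_big.
rewrite exchange_big big_distrr /=; apply: eq_bigr => w _.
have prod : s w * (#|G| - s w) = \sum_u \sum_v (w \in anc par u) && (w \notin anc par v).
  rewrite sC /s -!sum1_card big_distrl [LHS]big_mkcond; apply: eq_bigr => u _ /=.
  rewrite inE mul1n; case: ifP => _; last by rewrite big1.
  by rewrite [LHS]big_mkcond; apply: eq_bigr => v _; rewrite inE; case: ifP.
rewrite mul2n -addnn {1}prod {1}prod [X in _ = _ + X]exchange_big -big_split.
by apply: eq_bigr => u _; rewrite -big_split.
Qed.

(* All vertices off the diametral path hang on the half that ends in y. *)
Definition tight (G : sgraph) (o : bool) (r x y : G) (par : G -> G) : Prop :=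
  forall w, w \notin anc par x -> w \notin anc par y ->
    par w \in anc par y /\ (o -> par w != r).

(** * The defect identity and its equality case *)

Section Bound.
Variables (G : sgraph) (h : nat) (o : bool) (r c x y : G).
Variables (par : G -> G) (lev : G -> nat).
Hypothesis ctr : centered h o r c x y par lev.
Hypothesis lev_le : forall v, lev v <= h.
Implicit Types u v w z : G.
Local Notation A := (anc par).
Local Notation n := #|G|.

Let root_par : rooted r par. Proof. exact: ctr_rooted ctr. Qed.
Let par_r : par r = r. Proof. by case: root_par. Qed.
Let reach v : fconnect par v r. Proof. by case: root_par. Qed.

Let desc w := [set v | w \in A v].
Let s w := #|desc w|.
Let spine := A x :|: A y.
Let level k := [set v | lev v == k].
Let dft w := defect (level (lev w)) spine (h.+1 - lev w) s w.

Lemma lev_gt0_root w : 0 < lev w -> w != r.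
Proof. by apply: contraTneq => ->; rewrite (ctr_lev_r ctr). Qed.

(** Each vertex of level at least [k] has exactly one ancestor of level [k]. *)
Lemma sum_sizes k : 0 < k -> \sum_(w in level k) s w = #|[set v | k <= lev v]|.
Proof.
move=> k_gt0; under eq_bigr do rewrite /s -sum1_card big_mkcond.
rewrite exchange_big -sum1_card [RHS]big_mkcond; apply: eq_bigr => v _ /=.
rewrite -big_mkcondr sum1dep_card inE.
transitivity #|[set w in A v | lev w == k]|.
  by apply: eq_card => w; rewrite !inE andbC.
by rewrite (card_anc_eq_lev ctr) //; case: ifP.
Qed.

Lemma spine_size_ge w z : z \in [:: x; y] -> w \in A z -> 0 < lev w -> h.+1 - lev w <= s w.
Proof.
move=> zxy wz lw; have lz: lev z = h.
  by move: zxy; rewrite !inE => /orP[]/eqP->; [apply: ctr_lev_x ctr | apply: ctr_lev_y ctr].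
rewrite -lz -(card_anc_lev ctr _ lw); apply/subset_leq_card/subsetP=> v.
rewrite !inE => /andP[vz]; rewrite leq_eqVlt => /predU1P[eq_l | lt_l].
  by rewrite (anc_lev_inj ctr wz vz lw eq_l) anc_refl.
exact: (anc_le ctr wz vz).
Qed.

Lemma size_ge w : 0 < lev w -> base spine (h.+1 - lev w) w <= s w.
Proof.
move=> lw; rewrite /base; case: ifP => [/setUP[] ws|_].
- by apply: (@spine_size_ge _ x); rewrite ?mem_head.
- by apply: (@spine_size_ge _ y); rewrite ?inE ?eqxx ?orbT.
- by apply/card_gt0P; exists w; rewrite inE anc_refl.
Qed.

Lemma card_spine_level k : 0 < k -> k <= h -> #|level k :&: spine| = 2.
Proof.
move=> k_gt0 le_k; rewrite setIUr cardsU.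
rewrite (_ : level k :&: A x = [set w in A x | lev w == k]); last first.
  by apply/setP=> w; rewrite !inE andbC.
rewrite (_ : level k :&: A y = [set w in A y | lev w == k]); last first.
  by apply/setP=> w; rewrite !inE andbC.
rewrite !(card_anc_eq_lev ctr) // (ctr_lev_x ctr) (ctr_lev_y ctr) le_k.
rewrite (_ : _ :&: _ = set0) ?cards0 //; apply/setP=> w; rewrite !inE.
apply/negbTE/negP=> /andP[/andP[wx /eqP lw] /andP[wy _]].
by rewrite -lw (disj_lev0 ctr wx wy) (ctr_lev_r ctr) in k_gt0.
Qed.

(** The central edge cuts the path into two halves of [h + 1] vertices: [anc par y] without the root
    lies below [c], and [anc par x] avoids the descendants of [c]. *)
Lemma bicenter_size : o -> h.+1 <= s c /\ s c <= n - h.+1.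
Proof.
move=> oT; have [cr lc cy cx] := ctr_bicenter ctr oT; split.
  have <- : #|A y :\ r| = h.+1.
    have := cardsD1 r (A y); rewrite (anc_root reach) (card_anc ctr) oT cy (ctr_lev_y ctr) /=.
    by lia.
  apply/subset_leq_card/subsetP=> v; rewrite !inE => /andP[vr vy].
  have [lv | lv] := posnP (lev v).
    case: (ctr_lev0 ctr lv) => [vr' | [_ ->]]; last exact: anc_refl.
    by rewrite vr' eqxx in vr.
  by apply: (anc_le ctr cy vy); rewrite lc.
have <- : #|A x| = h.+1 by rewrite (card_anc ctr) (negPf cx) andbF addn0 (ctr_lev_x ctr).
rewrite leq_subRL; last exact: max_card.
rewrite addnC -leq_subRL ?max_card // -[n](cardsC (desc c)) addKn.
apply/subset_leq_card/subsetP=> v vx; rewrite !inE.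
by apply: contraNN cx => /anc_trans; apply.
Qed.

Lemma sum_levels (F : G -> nat) :
  \sum_(w | 0 < lev w) F w = \sum_(1 <= k < h.+1) \sum_(w in level k) F w.
Proof.
under [RHS]eq_bigr do rewrite big_mkcond.
rewrite [RHS]exchange_big big_mkcond; apply: eq_bigr => w _ /=.
rewrite -big_mkcond (eq_bigl (fun k => k == lev w)) => [|k]; last by rewrite inE eq_sym.
by rewrite big_nat1_eq ltnS lev_le andbT.
Qed.

(** The first summand is the central edge: with [a = h + 1], the difference between [s (n - s)] and
    [a (n - a)] factors as [(s - a) * (n - a - s)], both factors being nonnegative by
    [bicenter_size]. *)
Definition total_defect : nat :=
  o * ((s c - h.+1) * (n - h.+1 - s c)) +
  \sum_(1 <= k < h.+1) \sum_(w in level k) dft w.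

Lemma wiener_defect :
  double_wiener G +
    2 * \sum_(1 <= k < h.+1) level_bound (h.+1 - k) #|level k| #|[set v | k <= lev v]| =
  2 * (o * (h.+1 * (n - h.+1)) + \sum_(1 <= k < h.+1) n * #|[set v | k <= lev v]|)
    + 2 * total_defect.
Proof.
have s_le w : s w <= n by apply: max_card.
have -> : double_wiener G = 2 * (o * (s c * (n - s c)) +
    \sum_(1 <= k < h.+1) \sum_(w in level k) s w * (n - s w)).
  rewrite (double_wiener_sizes root_par) -sum_levels (bigID (fun w => lev w == 0)) /=.
  congr (2 * (_ + _)); last first.
    apply: eq_bigl => w; rewrite lt0n andb_idl // -lt0n.
    exact: lev_gt0_root.
  have [oT | oF] := boolP o.
    have [cr lc cy cx] := ctr_bicenter ctr oT.
    rewrite mul1n (big_pred1 c) // => w; apply/andP/eqP=> [[wr /eqP lw]|->].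
      by case: (ctr_lev0 ctr lw) => [wr'|[]//]; rewrite wr' eqxx in wr.
    by rewrite cr lc.
  rewrite big1 // => w /andP[wr /eqP lw].
  by rewrite (lev0_unicenter ctr oF lw) eqxx in wr.
rewrite -!mulnDr; congr (2 * _); rewrite /total_defect.
have -> : o * (s c * (n - s c)) =
    o * (h.+1 * (n - h.+1)) + o * ((s c - h.+1) * (n - h.+1 - s c)).
  have [oT | _] // := boolP o; have [] := bicenter_size oT.
  by move: (s c) n (s_le c) => a N; nia.
rewrite -!addnA; congr (_ + _); rewrite [RHS]addnCA; congr (_ + _).
rewrite -!big_split /=; apply: eq_big_nat => k /andP[k_gt0]; rewrite ltnS => le_k.
rewrite -sum_sizes // (@level_squares _ _ spine) ?subn_gt0 ?ltnS //; last 2 first.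
- by move=> w; rewrite inE => /eqP lw; rewrite -lw; apply: size_ge; rewrite lw.
- exact: card_spine_level.
rewrite addnA -big_split big_distrr /= /dft; congr (_ + _); last first.
  by apply: eq_bigr => w; rewrite inE => /eqP->.
by apply: eq_bigr => w _; rewrite -mulnn -mulnDr subnK // mulnC.
Qed.

Lemma defect_eq0 w : total_defect = 0 -> 0 < lev w -> dft w = 0.
Proof.
move=> /eqP; rewrite addn_eq0 -sum_levels => /andP[_]; rewrite sum_nat_eq0.
by move=> /forall_inP zero /zero /eqP.
Qed.

(** If [par w] were off the path, it would have base 1 and at least two descendants, on a level
    below [h], where the path bound is at least 2. The first term of its defect would be
    positive. *)
Lemma nonspine_child_spine w : w \notin spine -> total_defect = 0 -> par w \in spine.
Proof.
move=> ws def0; apply: contraNT ws => pws.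
have [lp | lp] := posnP (lev (par w)).
  case: (ctr_lev0 ctr lp) => [pw | [oT pw]]; move: pws; rewrite pw !inE ?(anc_root reach) //.
  by case: (ctr_bicenter ctr oT) => _ _ ->; rewrite orbT.
have lw: lev w = (lev (par w)).+1 by have := ctr_lev_par ctr w; lia.
have le_w := lev_le w; have := defect_eq0 def0 lp; rewrite /dft /defect.
have wr: w != r by apply: lev_gt0_root; rewrite lw.
have s2 : 1 < s (par w).
  have: [set w; par w] \subset desc (par w).
    by apply/subsetP=> z /set2P[]->; rewrite inE ?anc_refl ?anc_par.
  move/subset_leq_card; rewrite cards2.
  suff ->: w != par w by [].
  by apply: contraNneq (par_notin par_r reach wr) => <-; apply: anc_refl.
rewrite /excess /base (negPf pws) => /eqP; rewrite addn_eq0 !muln_eq0 /=.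
by lia.
Qed.

(** The lighter half is a bare path. With two central vertices, the vanishing first summand makes
    one side of the central edge have [h + 1] vertices, and then the lighter one does. With a single
    centre, the same follows from the branches of [x] and [y] on level 1. *)
Lemma near_set_sub : total_defect = 0 -> nearer x y <= nearer y x ->
  [set v | dist v x < dist v y] \subset A x.
Proof.
move=> def0; rewrite /nearer.
have [oT | oF] := boolP o.
  have [cr lc cy cx] := ctr_bicenter ctr oT.
  have -> : [set v | dist v x < dist v y] = ~: desc c.
    by apply/setP=> v; rewrite !inE (near_bicenter ctr).
  have -> : [set v | dist v y < dist v x] = desc c.
    by apply/setP=> v; rewrite !inE (near_bicenter_y ctr).
  have sAx : A x \subset ~: desc c.
    apply/subsetP=> v vx; rewrite !inE.
    by apply: contraNN cx => /anc_trans; apply.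
  have cAx : #|A x| = h.+1.
    by rewrite (card_anc ctr) (negPf cx) andbF addn0 (ctr_lev_x ctr).
  move=> le_near; rewrite -(eqP (_ : A x == ~: desc c)) // eqEcard sAx cAx.
  have [] := bicenter_size oT; have := cardsC (desc c); rewrite -/(s c) in le_near *.
  move/eqP: def0; rewrite addn_eq0 oT mul1n muln_eq0 => /andP[+ _].
  by move: le_near; move: #|~: desc c| => a; lia.
have nearE v : (dist v x < dist v y) = (A v :&: A x != [set r]) by apply: near_unicenter ctr _ oF.
have nearE' v : (dist v y < dist v x) = (A v :&: A y != [set r]).
  move: (ctr); rewrite (negPf oF) => /centered_swap ctr'.
  exact: near_unicenter ctr' _ isT.
have [h0 | h_gt0] := posnP h.
  move=> _; apply/subsetP=> v _; rewrite (_ : v = r) ?(anc_root reach) //.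
  by apply: (lev0_unicenter ctr oF); apply/eqP; rewrite -leqn0 -h0.
have branch z : lev z = h ->
    [set v | A v :&: A z != [set r]] = desc (iter h.-1 par z).
  move=> lz; set z1 := iter h.-1 par z.
  have lz1: lev z1 = 1 by rewrite (lev_iter ctr) lz; lia.
  have z1z: z1 \in A z by apply/ancP; exists h.-1.
  apply/setP=> v; rewrite !inE; apply/idP/idP=> [|z1v].
    rewrite eqEsubset sub1set (anc_cap_root ctr) andbT => /subsetPn[w].
    rewrite in_setI => /andP[wv wz]; rewrite inE => wr.
    have lw: 0 < lev w by rewrite lt0n; apply: contraNneq wr => /(lev0_unicenter ctr oF)->.
    have [lw1 | lw1] := eqVneq (lev z1) (lev w).
      by rewrite (anc_lev_inj ctr z1z wz _ lw1) // lz1.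
    by apply: anc_trans wv; apply: (anc_le ctr z1z wz); rewrite lz1 in lw1 *; lia.
  apply/eqP=> cap; have: z1 \in A v :&: A z by rewrite inE z1v.
  by rewrite cap inE => /eqP z1r; rewrite z1r (ctr_lev_r ctr) in lz1.
have lx := ctr_lev_x ctr; have ly := ctr_lev_y ctr.
have -> : [set v | dist v y < dist v x] = desc (iter h.-1 par y).
  by rewrite -branch //; apply/setP=> v; rewrite !inE nearE'.
have eX : [set v | dist v x < dist v y] = desc (iter h.-1 par x).
  by rewrite -branch //; apply/setP=> v; rewrite !inE nearE.
rewrite eX.
set x1 := iter h.-1 par x; set y1 := iter h.-1 par y => le_near.
have lx1: lev x1 = 1 by rewrite (lev_iter ctr) lx; lia.
have ly1: lev y1 = 1 by rewrite (lev_iter ctr) ly; lia.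
have x1x: x1 \in A x by apply/ancP; exists h.-1.
have y1y: y1 \in A y by apply/ancP; exists h.-1.
have y1x1: y1 != x1.
  apply: contra_eq_neq lx1 => eq1; rewrite eq1 in y1y.
  by rewrite (disj_lev0 ctr x1x y1y) (ctr_lev_r ctr).
(* If [x1] had excess, so would [y1], which is at least as heavy and has the same base [h]; their
   cross term in the defect would be positive. *)
have sx1: s x1 = h.
  have := size_ge (w := x1); have := size_ge (w := y1).
  rewrite /base !inE x1x y1y orbT lx1 ly1 subn1 /= => /(_ isT) ge_y /(_ isT) ge_x.
  apply/eqP; rewrite eqn_leq ge_x andbT leqNgt; apply/negP=> gt_x.
  have := defect_eq0 def0 (w := x1); rewrite lx1 => /(_ isT) /eqP.
  rewrite /dft lx1 /defect addn_eq0 => /andP[_]; rewrite muln_eq0.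
  rewrite (bigD1 y1) /=; last by rewrite inE ly1 y1x1.
  rewrite addn_eq0 /excess /base !inE x1x y1y orbT subn1 /= !subn_eq0.
  by rewrite -/(s x1) -/(s y1) in le_near; lia.
have sub: A x :\ r \subset desc x1.
  rewrite -(branch x lx); apply/subsetP=> v; rewrite !inE => /andP[vr vx].
  apply/eqP=> cap; have: v \in A v :&: A x by rewrite inE anc_refl.
  by rewrite cap inE (negPf vr).
have card : #|A x :\ r| = h.
  have := cardsD1 r (A x); rewrite (anc_root reach) // (card_anc ctr) (negPf oF) addn0 lx /=.
  by rewrite add1n => -[].
have /eqP <- : A x :\ r == desc x1.
  by rewrite eqEcard sub card (eq_leq sx1).
exact: subsetDl.
Qed.

(** A vertex off the path hangs on the path. Hung on the [x] half it would be nearer to [x], hence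
    on the path after all; the exception is the root in the unicentral case, which belongs to both
    halves. *)
Lemma tight_of_total_defect0 :
  total_defect = 0 -> nearer x y <= nearer y x -> tight o r x y par.
Proof.
move=> def0 /(near_set_sub def0) /subsetP near w wx wy.
have ws: w \notin spine by rewrite inE negb_or wx.
have lw: 0 < lev w.
  rewrite lt0n; apply: contraNneq ws => /(ctr_lev0 ctr)[->|[oT ->]].
    by rewrite inE (anc_root reach).
  by case: (ctr_bicenter ctr oT) => _ _ cy _; rewrite inE cy orbT.
have far: ~~ (dist w x < dist w y).
  by apply: contraNN wx => lt; apply: near; rewrite inE.
have far_x : par w \in A x -> ~~ o /\ par w = r.
  move=> px; have [oT | oF] := boolP o.
    have [cr lc cy cx] := ctr_bicenter ctr oT; case/negP: far.
    rewrite (near_bicenter ctr _ oT) ancS in_setU1 negb_or.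
    apply/andP; split; first by apply: contraTneq lw => <-; rewrite lc.
    by apply: contraNN cx => /anc_trans; apply.
  split=> //; apply/eqP; move: far; rewrite (near_unicenter ctr _ oF) negbK => /eqP cap.
  have: par w \in A w :&: A x by rewrite inE anc_par.
  by rewrite cap inE.
have := nonspine_child_spine ws def0; rewrite inE => /orP[/far_x[/negPf oF ->] | py].
  by rewrite (anc_root reach) // oF.
split=> // oT; apply/eqP=> pr; have := far_x; rewrite pr (anc_root reach) // oT.
by case.
Qed.

Lemma total_defect0_of_tight : tight o r x y par -> total_defect = 0.
Proof.
move=> tightG.
have par_tight w : w \notin spine -> par w \in A y /\ (o -> par w != r).
  by rewrite inE negb_or => /andP[wx wy]; apply: tightG.
(* Outside [anc par y], a path vertex has only path vertices below it and any other vertex only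
   itself, so the lower bounds on [s] are attained. *)
have excess_y w : 0 < lev w -> w \notin A y -> excess spine (h.+1 - lev w) s w = 0.
  move=> lw wy; rewrite /excess /base inE (negPf wy) orbF; apply/eqP; rewrite subn_eq0.
  case: ifPn => wx.
    rewrite -(ctr_lev_x ctr) -(card_anc_lev ctr _ lw).
    apply/subset_leq_card/subsetP=> v; rewrite !inE => wv.
    rewrite (lev_anc ctr wv) andbT; apply: contraNT wy => vx.
    have [vy | vy] := boolP (v \in A y); first exact: anc_trans wv vy.
    have [|pvy _] := par_tight v; first by rewrite inE negb_or vx.
    move: wv; rewrite ancS in_setU1 => /predU1P[wv | /anc_trans]; last exact.
    by rewrite -wv wx in vx.
  rewrite -(cards1 w); apply/subset_leq_card/subsetP=> v; rewrite !inE.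
  case/ancP=> [[|i] def_w]; first by rewrite def_w.
  set u := iter i par v; have pu : par u = w by rewrite def_w.
  have [|] := par_tight u; last by rewrite pu (negPf wy).
  have uw: w \in A u by rewrite -pu anc_par.
  by rewrite inE; apply/norP; split; [move: wx | move: wy]; apply: contraNN => /(anc_trans uw).
rewrite /total_defect (_ : o * _ = 0) ?add0n; last first.
  have [oT | _] := boolP o; last by rewrite mul0n.
  have [cr lc cy cx] := ctr_bicenter ctr oT; rewrite mul1n.
  have cAx : #|A x| = h.+1.
    by rewrite (card_anc ctr) (negPf cx) andbF addn0 (ctr_lev_x ctr).
  have c_anc v : v \in A y -> v != r -> c \in A v.
    move=> vy vr; have [lv | lv] := posnP (lev v).
      case: (ctr_lev0 ctr lv) => [vr' | [_ ->]]; last exact: anc_refl.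
      by rewrite vr' eqxx in vr.
    by apply: (anc_le ctr cy vy); rewrite lc.
  have: ~: desc c \subset A x.
    apply/subsetP=> v; rewrite !inE; apply: contraNT => vx.
    have vr: v != r by apply: contraNneq vx => ->; apply: anc_root.
    have [vy | vy] := boolP (v \in A y); first exact: c_anc.
    have [|pvy pvr] := par_tight v; first by rewrite inE negb_or vx.
    by rewrite ancS in_setU1 c_anc ?orbT ?pvr.
  move/subset_leq_card; rewrite cAx; have := cardsC (desc c); rewrite -/(s c).
  have [] := bicenter_size oT; move: #|~: desc c| => a ? ? ? ?.
  suff -> : n - h.+1 - s c = 0 by rewrite muln0.
  by lia.
rewrite -sum_levels big1 // => w lw; rewrite /dft /defect.
(* A vertex of [anc par y] has the full base [H] and is alone in [anc par y] on its level, so both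
   terms of its defect vanish. *)
have [wy | wy] := boolP (w \in A y); last by rewrite excess_y ?muln0.
rewrite {1}/base inE wy orbT subnn muln0 mul0n add0n.
rewrite big1 ?muln0 // => z /andP[]; rewrite inE => /eqP lz zw.
rewrite -lz excess_y ?lz //; apply: contraNN zw => zy; apply/eqP.
by apply: (anc_lev_inj ctr zy wy); rewrite lz.
Qed.

End Bound.

(** * Caterpillars *)

Section Caterpillar.
Variables (q h : nat) (o : bool) (t : seq nat).
Hypotheses (h_gt0 : 0 < h) (qE : q.+1 = h + h + o).

Local Notation T := (caterpillar q t).
Local Notation spine_vertex i := (inl (inord i : 'I_q.+2) : T).

(** The root is [v_(h+o)], the ends are [x = v_(q+1)] and [y = v_0]. In the bicentral case
    [c = v_h], so all attachment vertices [v_1, ..., v_h] lie on the side of [y]. The [maxn] makes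
    the root a fixed point. *)
Definition cat_par (v : T) : T :=
  match v with
  | inl i => spine_vertex (if i < h + o then i.+1 else maxn i.-1 (h + o))
  | inr p => spine_vertex (tag p).+1
  end.

Definition cat_lev (v : T) : nat :=
  match v with
  | inl i => if i <= h then h - i else i - (h + o)
  | inr p => h - tag p
  end.

Lemma uphalf_q : uphalf q = h.
Proof. by have := odd_double_half q.+1; case: o qE => /=; lia. Qed.

Lemma spine_vertexK i : i < q.+2 -> (inord i : 'I_q.+2) = i :> nat.
Proof. exact: inordK. Qed.

Lemma spine_vertexE (v : 'I_q.+2) : inl v = spine_vertex v.
Proof. by rewrite inord_val. Qed.

Lemma ord_lt (j : 'I_(uphalf q)) : j < h.
Proof. by rewrite -uphalf_q ltn_ord. Qed.

Lemma iter_left k i : i <= h + o ->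
  iter k cat_par (spine_vertex i) = spine_vertex (minn (i + k) (h + o)).
Proof.
move=> le_i; elim: k => [|k IHk] /=; first by rewrite addn0 (minn_idPl le_i).
by rewrite IHk /= spine_vertexK; [congr (inl (inord _)); case: ifP; lia | lia].
Qed.

Lemma iter_right k i : h + o <= i -> i < q.+2 ->
  iter k cat_par (spine_vertex i) = spine_vertex (maxn (i - k) (h + o)).
Proof.
move=> le_i lt_i; elim: k => [|k IHk] /=; first by rewrite subn0 (maxn_idPl le_i).
by rewrite IHk /= spine_vertexK; [congr (inl (inord _)); case: ifP; lia | lia].
Qed.

Lemma cat_rooted : rooted (spine_vertex (h + o)) cat_par.
Proof.
split.
- by rewrite /= spine_vertexK; [congr (inl (inord _)); case: ifP; lia | lia].
- have spine_reach i : i < q.+2 -> fconnect cat_par (spine_vertex i) (spine_vertex (h + o)).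
    move=> lt_i; rewrite -in_anc; apply/ancP.
    have [le_i | lt_hi] := leqP i (h + o).
      exists (h + o - i); rewrite iter_left //; congr (inl (inord _)); lia.
    exists (i - (h + o)); rewrite iter_right //; [congr (inl (inord _)); lia | exact: ltnW].
  case=> [i | [a e]]; first by rewrite (spine_vertexE i) spine_reach.
  apply: connect_trans (fconnect1 _ _) _; apply: spine_reach.
  by rewrite /=; have := ord_lt a; lia.
have eqE (i j : 'I_q.+2) : (inl i == inl j :> T) = (i == j :> nat) by [].
move=> [i | [a e]] [j | [a' e']] /=.
- rewrite !eqE !spine_vertexK; try by have := ltn_ord i; have := ltn_ord j; case: ifP; lia.
  by case: ifP; case: ifP; lia.
- rewrite eqE spine_vertexK; last by have := ord_lt a'; lia.
  exact/esym/orbF.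
- rewrite eqE spine_vertexK; last by have := ord_lt a; lia.
  by [].
- exact/esym/andbF.
Qed.

Lemma anc_first : anc cat_par (spine_vertex 0) = [set spine_vertex i | i : 'I_(h + o).+1].
Proof.
apply/setP=> v; apply/ancP/imsetP=> [[k ->]|[i _ ->]].
  have lt: minn k (h + o) < (h + o).+1 by rewrite ltnS geq_minr.
  by exists (Ordinal lt); rewrite // iter_left.
exists i; rewrite iter_left //; congr (inl (inord _)).
by rewrite (minn_idPl _) // -ltnS ltn_ord.
Qed.

Lemma anc_last : anc cat_par (spine_vertex q.+1) = [set spine_vertex (h + o + i) | i : 'I_h.+1].
Proof.
apply/setP=> v; apply/ancP/imsetP=> [[k ->]|[i _ ->]].
  have lt: h - k < h.+1 by lia.
  exists (Ordinal lt); rewrite // iter_right; [|lia|lia].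
  by congr (inl (inord _)); rewrite /=; lia.
exists (h - i); have := ltn_ord i => lt_i; rewrite iter_right; [|lia|lia].
by congr (inl (inord _)); lia.
Qed.

Lemma cat_centered :
  centered h o (spine_vertex (h + o)) (spine_vertex h) (spine_vertex q.+1) (spine_vertex 0)
    cat_par cat_lev.
Proof.
have inj i j : i < q.+2 -> j < q.+2 -> spine_vertex i = spine_vertex j -> i = j.
  by move=> lt_i lt_j [] /(congr1 val) /=; rewrite !spine_vertexK.
split.
- exact: cat_rooted.
- case=> [i | [a e]] /=.
    have lt_i := ltn_ord i; have o_le : o <= 1 by case: (o).
    rewrite spine_vertexK; last by case: ifP; lia.
    by case: ltnP => le1; case: leqP => le2; case: leqP => le3; lia.
  have lt_a := ord_lt a; rewrite spine_vertexK; last by lia.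
  by case: ifP; lia.
- case=> [i | [a e]] /=; last by have := ord_lt a; lia.
  rewrite (spine_vertexE i) => lev0; have := ltn_ord i => lt_i.
  have [-> | neq] := eqVneq (i : nat) (h + o); [by left | right].
  have oT: o by move: lev0 neq qE; case: o; case: ifP; lia.
  by split=> //; congr (inl (inord _)); move: lev0 neq; rewrite oT; case: ifP; lia.
- by rewrite /= spine_vertexK; [case: ifP; lia | lia].
- move=> oT; split.
  + by apply/eqP=> /inj; rewrite oT; lia.
  + by rewrite /= spine_vertexK; [case: ifP; lia | lia].
  + rewrite anc_first; have lt: h < (h + o).+1 by lia.
    by apply/imsetP; exists (Ordinal lt).
  + rewrite anc_last; apply/imsetP=> -[i _ /inj]; have := ltn_ord i; rewrite oT.
    by lia.
- by rewrite /= spine_vertexK; [case: ifP; lia | lia].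
- by rewrite /= spine_vertexK // subn0.
apply/setP=> v; rewrite !inE anc_last anc_first; apply/andP/eqP=> [[]|->].
  case/imsetP=> i _ -> /imsetP[j _ /inj eq_ij]; have := ltn_ord i; have := ltn_ord j.
  by move=> lt_j lt_i; congr (inl (inord _)); lia.
split; apply/imsetP; first by exists ord0; rewrite ?addn0.
by exists ord_max.
Qed.

Lemma cat_lev_le v : cat_lev v <= h.
Proof.
case: v => [i | [a e]] /=; last exact: leq_subr.
by have := ltn_ord i; case: ifP; lia.
Qed.

Lemma spine_inl (i : 'I_q.+2) :
  (inl i : T) \in anc cat_par (spine_vertex q.+1) :|: anc cat_par (spine_vertex 0).
Proof.
rewrite inE anc_last anc_first (spine_vertexE i); have := ltn_ord i => lt_i.
have [le_i | gt_i] := leqP i (h + o).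
  apply/orP; right; apply/imsetP; rewrite -ltnS in le_i.
  by exists (Ordinal le_i).
apply/orP; left; have lt: i - (h + o) < h.+1 by lia.
by apply/imsetP; exists (Ordinal lt); rewrite // subnKC // ltnW.
Qed.

Lemma cat_tight :
  tight o (spine_vertex (h + o)) (spine_vertex q.+1) (spine_vertex 0) cat_par.
Proof.
case=> [i | [a e]] vx vy.
  by have := spine_inl i; rewrite inE (negPf vx) (negPf vy).
have lt_a := ord_lt a; split.
  have lt: a.+1 < (h + o).+1 by lia.
  by rewrite anc_first; apply/imsetP; exists (Ordinal lt).
move=> oT; apply/eqP=> -[] /(congr1 val) /=.
by have := oT; rewrite !spine_vertexK; lia.
Qed.

(** The pendant vertices with tag [j] hang at [v_(j+1)], whose level is [h - j - 1]; their own level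
    is [h - j]. *)
Lemma card_cat_level k : 0 < k -> k <= h ->
  #|[set v | cat_lev v == k] :\:
    (anc cat_par (spine_vertex q.+1) :|: anc cat_par (spine_vertex 0))| = nth 0 t (h - k).
Proof.
move=> k_gt0 le_k; have lt_j: h - k < uphalf q by rewrite uphalf_q; lia.
pose j := Ordinal lt_j.
pose f (i : 'I_(nth 0 t j)) : T := inr (Tagged (fun j : 'I_(uphalf q) => 'I_(nth 0 t j)) i).
have f_inj : injective f by move=> a b [] /eqP; rewrite eq_Tagged => /eqP.
rewrite -[RHS](card_ord (nth 0 t j)) -cardsT -(card_imset _ f_inj).
apply: eq_card => v; rewrite in_setD; apply/andP/imsetP=> [[vs]|[i _ ->]].
  case: v vs => [i | [a e]]; first by rewrite spine_inl.
  rewrite inE /= => _ /eqP lev_p; have lt_a := ord_lt a.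
  have eq_j: a = j by apply: val_inj => /=; lia.
  by subst a; exists e.
rewrite !inE /= subKn // eqxx anc_last anc_first; split=> //.
by apply/norP; split; apply/imsetP=> -[].
Qed.

End Caterpillar.

(** Adjacency is expressed by the parent map, so commuting with it suffices. The map goes from [H]
    to [G] because the explicit map starts from the caterpillar. *)
Lemma rooted_iso (G H : sgraph) (rG : G) (rH : H) parG parH (f : H -> G) :
  rooted rG parG -> rooted rH parH -> bijective f ->
  (forall v, f (parH v) = parG (f v)) -> iso G H.
Proof.
move=> [_ _ adjG] [_ _ adjH] bij_f f_par; have inj_f := bij_inj bij_f.
case: (bij_f) => g fK gK; exists g; first by exists f.
move=> u v; rewrite -{2}(gK u) -{2}(gK v); move: (g u) (g v) => a b.
by rewrite adjG adjH -!f_par !(inj_eq inj_f).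
Qed.

(** * Level sizes read off the eccentric sequence *)

Section CenteredSequence.
Variables (G : sgraph) (h : nat) (o : bool) (r c x y : G).
Variables (par : G -> G) (lev : G -> nat).
Hypothesis ctr : centered h o r c x y par lev.
Hypothesis lev_le : forall v, lev v <= h.

Local Notation level k := [set v | lev v == k].

Lemma count_ecc_seq (P : pred nat) : count P (ecc_seq G) = #|[set v : G | P (ecc v)]|.
Proof.
rewrite /ecc_seq count_sort count_map cardE -size_filter /enum_mem.
by rewrite -filter_predI; congr (size _); apply: eq_filter => v; rewrite /= inE andbT.
Qed.

Lemma size_ecc_seq : size (ecc_seq G) = #|G|.
Proof. by rewrite size_sort size_map cardE. Qed.

Lemma card_level k : #|level k| = count_mem (k + h + o) (ecc_seq G).
Proof.
rewrite count_ecc_seq; apply: eq_card => v; rewrite !inE (ecc_lev ctr lev_le).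
by rewrite !eqn_add2r.
Qed.

Lemma card_level_ge k : #|[set v | k <= lev v]| = count (leq (k + h + o)) (ecc_seq G).
Proof.
rewrite count_ecc_seq; apply: eq_card => v; rewrite !inE (ecc_lev ctr lev_le).
by rewrite !leq_add2r.
Qed.

Lemma card_level0 : #|level 0| = o.+1.
Proof.
have [oT | oF] := boolP o.
  have [cr lc _ _] := ctr_bicenter ctr oT.
  rewrite (_ : level 0 = [set c; r]) ?cards2 ?cr //.
  apply/setP=> v; rewrite !inE; apply/eqP/orP=> [/(ctr_lev0 ctr)[->|[_ ->]]|].
  - by right.
  - by left.
  - by case=> /eqP->; rewrite ?lc ?(ctr_lev_r ctr).
rewrite (_ : level 0 = [set r]) ?cards1 //; apply/setP=> v; rewrite !inE.
by apply/eqP/eqP=> [/(lev0_unicenter ctr oF) //|->]; apply: ctr_lev_r ctr.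
Qed.

Lemma level_gt k : h < k -> #|level k| = 0.
Proof.
move=> lt_k; apply/eqP; rewrite cards_eq0; apply/eqP/setP=> v; rewrite !inE.
by apply: contraTF lt_k => /eqP <-; rewrite -leqNgt.
Qed.

(** No value between radius and diameter is skipped: the ancestors of [x] run through all levels. *)
Lemma mem_ecc_seq a : (a \in ecc_seq G) = (h + o <= a <= h + h + o).
Proof.
rewrite -has_pred1 has_count count_ecc_seq.
apply/card_gt0P/andP=> [[v]|[le1 le2]].
  by rewrite inE /= (ecc_lev ctr lev_le) => /eqP<-; have := lev_le v; lia.
exists (iter (h + h + o - a) par x).
by rewrite inE /= (ecc_lev ctr lev_le) (lev_iter ctr) (ctr_lev_x ctr); apply/eqP; lia.
Qed.

Lemma card_level_split k : 0 < k -> k <= h ->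
  #|level k| = 2 + #|level k :\: (anc par x :|: anc par y)|.
Proof.
move=> k_gt0 le_k.
by rewrite -(cardsID (anc par x :|: anc par y)) (card_spine_level ctr).
Qed.

End CenteredSequence.

Lemma centered_same (G G' : sgraph) h h' (o o' : bool) r r' c c' x x' y y' par par' lev lev' :
  @centered G h o r c x y par lev -> (forall v, lev v <= h) ->
  @centered G' h' o' r' c' x' y' par' lev' -> (forall v, lev' v <= h') ->
  ecc_seq G = ecc_seq G' -> h = h' /\ o = o'.
Proof.
move=> ctr le_h ctr' le_h' eq_S.
have mG := mem_ecc_seq ctr le_h; have mG' := mem_ecc_seq ctr' le_h'.
have := mG (h + h + o); have := mG' (h' + h' + o'); rewrite -eq_S mG eq_S mG'.
rewrite !leqnn !andbT; case: (o) (o') => -[]; lia.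
Qed.

(** * Tight trees are caterpillars *)

Section Structure.
Variables (G : sgraph) (h : nat) (o : bool) (r c x y : G).
Variables (par : G -> G) (lev : G -> nat).
Hypothesis ctr : centered h o r c x y par lev.
Hypothesis lev_le : forall v, lev v <= h.
Hypothesis tightG : tight o r x y par.
Variables (q : nat) (t : seq nat).
Hypotheses (h_gt0 : 0 < h) (qE : q.+1 = h + h + o).

Local Notation A := (anc par).
Local Notation T := (caterpillar q t).
Local Notation spine := (A x :|: A y).
Local Notation pendants k := ([set v | lev v == k] :\: spine).

Hypothesis tE : forall j, j < h -> nth 0 t j = #|pendants (h - j)|.
Hypothesis card_le : #|G| <= #|T|.

Let root_par : rooted r par. Proof. exact: ctr_rooted ctr. Qed.
Let par_r : par r = r. Proof. by case: root_par. Qed.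
Let reach v : fconnect par v r. Proof. by case: root_par. Qed.

Lemma pendant_enum (j : 'I_(uphalf q)) : nth 0 t j = #|pendants (h - j)|.
Proof. by apply: tE; apply: (ord_lt h_gt0 qE). Qed.

(** The path is walked from [y] up to the root, then down to [x]; the pendant vertices with tag [j]
    enumerate the off-path vertices of level [h - j]. *)
Definition cat_map (v : T) : G :=
  match v with
  | inl i => if i <= h + o then iter i par y else iter (q.+1 - i) par x
  | inr p => enum_val (cast_ord (pendant_enum (tag p)) (tagged p))
  end.

Lemma iter_y_root : iter (h + o) par y = r.
Proof.
have [oT | oF] := boolP o; last first.
  apply: (lev0_unicenter ctr oF).
  by rewrite (lev_iter ctr) (ctr_lev_y ctr) addn0 subnn.
rewrite addn1 iterS; have [cr lc cy cx] := ctr_bicenter ctr oT.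
have: lev (iter h par y) = 0 by rewrite (lev_iter ctr) (ctr_lev_y ctr) subnn.
case/(ctr_lev0 ctr) => [->|[_ ->]]; first exact: par_r.
exact: bicenter_par ctr oT.
Qed.

Lemma iter_x_root : iter h par x = r.
Proof.
have: lev (iter h par x) = 0 by rewrite (lev_iter ctr) (ctr_lev_x ctr) subnn.
case/(ctr_lev0 ctr) => // -[oT def_c]; have [_ _ _] := ctr_bicenter ctr oT.
by rewrite -def_c; case/negP; apply/ancP; exists h.
Qed.

Lemma cat_map_par v : cat_map (cat_par h o v) = par (cat_map v).
Proof.
case: v => [i | [j e]].
  have lt_i := ltn_ord i.
  rewrite /= spine_vertexK; last by case: ifP; lia.
  case: (ltngtP i (h + o)) => [lt | gt | eq_i].
  - by rewrite lt.
  - rewrite [maxn _ _](_ : _ = i.-1); last by lia.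
    (* The predecessor of [v_(h+o+1)] is the root, which [cat_map] reaches from [y] and not from
       [x]. *)
    case: ifP => [le1 | _].
      have -> : i.-1 = h + o by lia.
      rewrite iter_y_root -iter_x_root -iterS; congr (iter _ _ _); lia.
    by rewrite -iterS; congr (iter _ _ _); lia.
  - rewrite [maxn _ _](_ : _ = h + o); last by lia.
    by rewrite leqnn eq_i iter_y_root par_r.
have lt_j := ord_lt h_gt0 qE j; set w := cat_map (inr _).
have: w \in pendants (h - j) by apply: (enum_valP (cast_ord (pendant_enum j) e)).
rewrite !inE negb_or => /andP[/andP[wx wy] /eqP lw].
have [pwy pwr] := tightG wx wy.
rewrite /= spine_vertexK; last by rewrite /=; lia.
rewrite (_ : j.+1 <= h + o = true); last by lia.
case/ancP: pwy => k def_pw; rewrite def_pw.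
have := ctr_lev_par ctr w; rewrite lw def_pw (lev_iter ctr) (ctr_lev_y ctr) => eq_k.
have [lt_jh | ge_jh] := ltnP j.+1 h; first by have -> : k = j.+1 by lia.
(* Now the parent has level 0, which does not determine [k]. Without a bicentre it is the root;
   otherwise tightness excludes the root and leaves [c], the iterate [h] of [y]. *)
have eq_jh : j.+1 = h by lia.
rewrite [LHS](_ : _ = iter h par y); last by rewrite -eq_jh.
have le_k : h <= k by lia.
have [-> // | neq] := eqVneq k h.
have lt_k : h < k by rewrite ltn_neqAle eq_sym neq.
have [oT | oF] := boolP o; last first.
  rewrite -(subnK le_k) iterD.
  have -> : iter h par y = r by have := iter_y_root; rewrite (negPf oF) addn0.
  by rewrite iter_root.
have: par w != r by apply: pwr.
rewrite def_pw -(subnK lt_k) iterD.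
have -> : iter h.+1 par y = r by have := iter_y_root; rewrite oT addn1.
by rewrite iter_root // eqxx.
Qed.

Lemma cat_map_inj : injective cat_map.
Proof.
have in_y i : iter i par y \in A y by apply/ancP; exists i.
have in_x i : iter i par x \in A x by apply/ancP; exists i.
have spine_pendant (i : 'I_q.+2) p : cat_map (inl i) != cat_map (inr p).
  have: cat_map (inr p) \in pendants (h - tag p).
    by apply: (enum_valP (cast_ord (pendant_enum (tag p)) (tagged p))).
  rewrite !inE negb_or => /andP[/andP[wx wy] _].
  by apply: contraNneq wx => eq_w; move: wy; rewrite -eq_w /=; case: ifP; rewrite ?in_y ?in_x.
(* On the [y] side positions are told apart by depth, since [r] and [c] share level 0. *)
have ry: dist r y = h + o.
  apply: succn_inj; rewrite (dist_root root_par) (card_anc ctr) (ctr_lev_y ctr).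
  have [oT | _] := boolP o; last by rewrite /= !addn0.
  by have [_ _ -> _] := ctr_bicenter ctr oT; rewrite addSn.
have y_inj i j : i <= h + o -> j <= h + o -> iter i par y = iter j par y -> i = j.
  by move=> le_i le_j /(congr1 (dist r)); rewrite !(dist_iter _ _ root_par) ry; lia.
have x_inj i j : i <= h -> j <= h -> iter i par x = iter j par x -> i = j.
  by move=> le_i le_j /(congr1 lev); rewrite !(lev_iter ctr) (ctr_lev_x ctr); lia.
have xy i j : i < h -> iter i par x <> iter j par y.
  move=> lt_i eq_xy; have /(congr1 lev): iter i par x = r.
    by apply: (disj_lev0 ctr (in_x i)); rewrite eq_xy.
  by rewrite (lev_iter ctr) (ctr_lev_x ctr) (ctr_lev_r ctr); lia.
move=> [i | p] [j | p'] eq_f; last 1 first.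
- have lev_p p0 : lev (cat_map (inr p0)) = h - tag p0.
    have: cat_map (inr p0) \in pendants (h - tag p0).
      by apply: (enum_valP (cast_ord (pendant_enum (tag p0)) (tagged p0))).
    by rewrite !inE => /andP[_ /eqP].
  have := lev_p p; rewrite eq_f lev_p.
  case: p p' eq_f {lev_p} => [a e] [a' e'] /= eq_f eq_a.
  have {eq_a} eq_a : a = a'.
    by apply: val_inj => /=; have := ord_lt h_gt0 qE a; have := ord_lt h_gt0 qE a'; lia.
  by subst a'; move/enum_val_inj/cast_ord_inj: eq_f => ->.
- have := ltn_ord i; have := ltn_ord j => lt_j lt_i; congr inl; apply: val_inj => /=.
  move: eq_f => /=; case: leqP => le_i; case: leqP => le_j.
  + exact: y_inj.
  + by move/esym/xy => []; lia.
  + by move/xy => []; lia.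
  + by move/x_inj; lia.
- by have := spine_pendant i p'; rewrite eq_f eqxx.
- by have := spine_pendant j p; rewrite eq_f eqxx.
Qed.

Lemma tight_iso : iso G T.
Proof.
apply: (@rooted_iso G T _ _ _ _ cat_map root_par (cat_rooted t h_gt0 qE)) cat_map_par.
exact: inj_card_bij cat_map_inj card_le.
Qed.

End Structure.

(** * Multiplicities, and the bound as a function of the sequence *)

Lemma count_seq_of_mult a (b m : seq nat) : uniq b -> size b = size m ->
  count_mem a (seq_of_mult b m) = if a \in b then nth 0 m (index a b) else 0.
Proof.
elim: b m => [|b0 b IHb] [|m0 m] //= /andP[b0b Ub] [eq_sz].
rewrite /seq_of_mult /= count_cat count_nseq -/(seq_of_mult b m) IHb // in_cons /=.
have [<- | neq] := eqVneq b0 a; first by rewrite (negPf b0b) mul1n addn0.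
by [].
Qed.

Lemma size_seq_of_mult (b m : seq nat) : size b = size m ->
  size (seq_of_mult b m) = sumn m.
Proof.
elim: b m => [|b0 b IHb] [|m0 m] //= [eq_sz].
by rewrite /seq_of_mult /= size_cat size_nseq -/(seq_of_mult b m) IHb.
Qed.

Section SameSequence.
Variables (S : seq nat) (h : nat) (o : bool).

Definition sequence_bound : nat :=
  o * (h.+1 * (size S - h.+1)) + \sum_(1 <= k < h.+1) size S * count (leq (k + h + o)) S.

Definition sequence_squares : nat :=
  \sum_(1 <= k < h.+1) level_bound (h.+1 - k) (count_mem (k + h + o) S)
                         (count (leq (k + h + o)) S).

Lemma wiener_sequence (G : sgraph) (r c x y : G) par lev :
  centered h o r c x y par lev -> (forall v, lev v <= h) -> ecc_seq G = S ->
  double_wiener G + 2 * sequence_squares =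
  2 * sequence_bound + 2 * total_defect h o c x y par lev.
Proof.
move=> ctr lev_le eq_S; have := wiener_defect ctr lev_le.
rewrite /sequence_squares /sequence_bound -eq_S size_ecc_seq.
under eq_bigr do rewrite (card_level ctr lev_le) (card_level_ge ctr lev_le).
by under [X in _ = 2 * (_ + X) + _ -> _]eq_bigr do rewrite (card_level_ge ctr lev_le).
Qed.

End SameSequence.

Section CaterpillarSequence.
Variables (G : sgraph) (h : nat) (o : bool) (r c x y : G).
Variables (par : G -> G) (lev : G -> nat).
Hypothesis ctr : centered h o r c x y par lev.
Hypothesis lev_le : forall v, lev v <= h.
Variables (q : nat) (t : seq nat).
Hypotheses (h_gt0 : 0 < h) (qE : q.+1 = h + h + o).
Hypothesis tE : forall j, j < h -> nth 0 t j = count_mem (h - j + h + o) (ecc_seq G) - 2.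

(** Two sorted sequences with equal multiplicities coincide. As [G] realises the sequence, each
    level from 1 to [h] has at least two vertices, so the truncated subtraction in [tE] loses
    nothing. *)
Lemma cat_ecc_seq : ecc_seq (caterpillar q t) = ecc_seq G.
Proof.
have catC := cat_centered t h_gt0 qE; have cat_le := cat_lev_le (t := t) h_gt0 qE.
have eq_level k : #|[set v : G | lev v == k]| = #|[set v : caterpillar q t | cat_lev h o v == k]|.
  have [-> | k_gt0] := posnP k; first by rewrite (card_level0 ctr) (card_level0 catC).
  have [le_k | lt_k] := leqP k h; last by rewrite (level_gt lev_le) // (level_gt cat_le).
  rewrite (card_level_split catC) // card_cat_level // tE; last by lia.
  rewrite subKn // -(card_level ctr lev_le) subnKC //.
  by rewrite (card_level_split ctr) // leq_addr.
have sorted_ecc (H : sgraph) : sorted leq (ecc_seq H) by apply: sort_sorted leq_total _.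
apply: (sorted_eq leq_trans anti_leq) => //.
apply/allP=> a _ /=; apply/eqP.
have [le_a | lt_a] := leqP (h + o) a.
  have -> : a = a - (h + o) + h + o by lia.
  by rewrite -(card_level catC cat_le) -(card_level ctr lev_le) eq_level.
by rewrite !(count_memPn _) // (mem_ecc_seq ctr lev_le, mem_ecc_seq catC cat_le) leqNgt lt_a.
Qed.

End CaterpillarSequence.

Theorem corollary7 (l : nat) (b m : l.-tuple nat)
    (b_incr : sorted ltn b) (m_pos : forall i : 'I_l, 0 < tnth m i)
    (S_tree : tree_ecc_seq (seq_of_mult b m))
    (S_size : 2 < \sum_(i < l) tnth m i)
    (I : top_index) :
  let T := caterpillar (last 0 b).-1 [seq k - 2 | k <- rev (behead m)] in
  minimises I (seq_of_mult b m) T /\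
  forall G : sgraph, minimises I (seq_of_mult b m) G -> iso G T.
Proof.
set S := seq_of_mult b m; set q := (last 0 b).-1; set t := [seq k - 2 | k <- rev (behead m)].
move=> T; case: S_tree => G0 treeG0 eq_S0.
have [h [o [r0 [c0 [x0 [y0 [par0 [lev0 [ctr0 le0 _]]]]]]]]] := tree_centered treeG0.
have eq_sz : size b = size m by rewrite !size_tuple.
have Ub : uniq b := sorted_uniq ltn_trans ltnn b_incr.
have countS a : count_mem a S = if a \in val b then nth 0 m (index a b) else 0.
  exact: count_seq_of_mult.
have mem_b a : (a \in val b) = (h + o <= a <= h + h + o).
  rewrite -(mem_ecc_seq ctr0 le0) eq_S0 -[RHS]has_pred1 [RHS]has_count countS.
  case: ifP => // ab; have lt_a : index a b < l by rewrite -[X in _ < X](size_tuple b) index_mem.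
  by have := m_pos (Ordinal lt_a); rewrite (tnth_nth 0).
have def_b : val b = iota (h + o) h.+1.
  apply: (irr_sorted_eq ltn_trans ltnn) => //; first exact: iota_ltn_sorted.
  by move=> a; rewrite mem_b mem_iota; lia.
have size_S : size S = \sum_(i < l) tnth m i.
  by rewrite size_seq_of_mult // sumnE big_tuple; apply: eq_bigr.
(* If [h = 0], every vertex is central, so there are at most two. *)
have h_gt0 : 0 < h.
  rewrite lt0n; apply: contraTneq S_size => h0.
  rewrite -size_S /S -eq_S0 size_ecc_seq -leqNgt -cardsT.
  have <- : [set v | lev0 v == 0] = [set: G0].
    by apply/setP=> v; rewrite !inE -leqn0 -h0 le0.
  by rewrite (card_level0 ctr0); case: (o).
have last_b : last 0 b = h + h + o.
  by rewrite def_b -addn1 iotaD cats1 last_rcons; lia.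
have qE : q.+1 = h + h + o by rewrite /q last_b; lia.
have size_m : size m = h.+1 by rewrite -eq_sz def_b size_iota.
(* [behead] drops the multiplicity of the central vertices; after the reversal entry [j] belongs to
   level [h - j], as entry [i] of [b] is the eccentricity [h + o + i]. *)
have tE j : j < h -> nth 0 t j = count_mem (h - j + h + o) S - 2.
  move=> lt_j; rewrite (nth_map 0) ?size_rev ?size_behead ?size_m //.
  rewrite nth_rev ?size_behead ?size_m // nth_behead.
  have nth_b : nth 0 b (h - j) = h - j + h + o by rewrite def_b nth_iota; lia.
  have lt_b : h - j < size b by rewrite eq_sz size_m; lia.
  by rewrite -nth_b countS mem_nth // index_uniq //= subnSK.
have catC := cat_centered t h_gt0 qE; have cat_le := cat_lev_le (t := t) h_gt0 qE.
have treeT : is_tree T by apply: rooted_is_tree (ctr_rooted catC).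
have eq_ST : ecc_seq T = S.
  by rewrite /T (cat_ecc_seq ctr0 le0 h_gt0 qE) eq_S0.
have wT := wiener_sequence catC cat_le eq_ST.
rewrite (total_defect0_of_tight catC cat_le (cat_tight h_gt0 qE)) -/T in wT.
have treeC G : is_tree G -> ecc_seq G = S -> exists r c x y par lev,
    [/\ @centered G h o r c x y par lev, forall v, lev v <= h & nearer x y <= nearer y x].
  move=> treeG eq_SG.
  have [h' [o' [r [c [x [y [par [lev [ctr le_h near]]]]]]]]] := tree_centered treeG.
  have [|eh eo] := centered_same ctr0 le0 ctr le_h; first by rewrite eq_S0.
  by subst h' o'; exists r, c, x, y, par, lev.
have cardT G : ecc_seq G = S -> #|G| = #|T|.
  by move=> eq_SG; rewrite -!size_ecc_seq eq_SG eq_ST.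
split.
  split=> // H treeH eq_SH; rewrite index_val_le //; last by rewrite (cardT H).
  have [r [c [x [y [par [lev [ctr le_h _]]]]]]] := treeC H treeH eq_SH.
  by have := wiener_sequence ctr le_h eq_SH; lia.
move=> G [treeG eq_SG /(_ T treeT eq_ST)].
rewrite index_val_le // => [le_w|]; last exact: cardT.
have [r [c [x [y [par [lev [ctr le_h near]]]]]]] := treeC G treeG eq_SG.
have wG := wiener_sequence ctr le_h eq_SG.
(* The caterpillar has defect 0, so a tree with no larger Wiener index and the same sequence has
   defect 0 as well. *)
have tightG : tight o r x y par.
  by apply: (tight_of_total_defect0 ctr le_h) near; lia.
apply: (tight_iso ctr tightG h_gt0 qE); last by rewrite (cardT G).
move=> j lt_j; rewrite tE // -eq_SG -(card_level ctr le_h).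
by rewrite (card_level_split ctr) ?addKn //; lia.
Qed.
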